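(* Let $n\ge2$, let $f=(f_1,\dots,f_n)$ be a polynomial system on $\mathbb{C}^n$, let $\xi$ be a simple triple zero of $f$ such that $Df(\xi)$ has the normalized form, let $z\in\mathbb{C}^n$, $z\neq\xi$, be an approximate zero, and put $u=\gamma_3(f,\xi)^3\|z-\xi\|$. Let $N_f$ be the modified Newton iteration for simple triple zeros and $b_{2,1},b_{3,3}$ the rational functions defined in the context. (1) If $u<u_3\approx0.0222$, where $u_3$ is the smallest positive solution of the equation $2b_{2,1}(u)^2+2b_{3,3}(u)^2=1$, then $$\|N_f(z)-\xi\|<\|z-\xi\|.$$ (2) If $u<u_3'\approx0.0154$, where $u_3'$ is the smallest positive solution of the equation $2b_{2,1}(u)^2+2b_{3,3}(u)^2=\frac14$, then after $k\ge1$ iterations $$\|N_f^k(z)-\xi\|<\left(\tfrac12\right)^{2^k-1}\|z-\xi\|.$$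
   Context: Notation. $X=(X_1,\hat X)$, $\hat X=(X_2,\dots,X_n)$, $\hat f=(f_1,\dots,f_{n-1})$; $D\hat f$ is the $(n-1)\times(n-1)$ Jacobian of $\hat f$ with respect to $\hat X$; for $k\ge2$, $D^k\hat f$ and $D^kf_n$ are the $k$-th derivatives with respect to all variables $X_1,\dots,X_n$. $\|\cdot\|$ is the Hermitian norm on vectors and the operator norm on matrices and multilinear maps. Simple triple zero with normalized Jacobian: $f(\xi)=0$, $D\hat f(\xi)$ is invertible, $\frac{\partial f_i(\xi)}{\partial X_1}=0$ and $\frac{\partial f_n(\xi)}{\partial X_i}=0$ for $1\le i\le n$, $\frac{\partial^2f_n(\xi)}{\partial X_1^2}=0$, and $$\Delta_3(f_n)=\frac16\frac{\partial^3f_n(\xi)}{\partial X_1^3}-\frac{\partial^2f_n(\xi)}{\partial X_1\partial\hat X}\cdot D\hat f(\xi)^{-1}\,\frac12\frac{\partial^2\hat f(\xi)}{\partial X_1^2}\ne0.$$ $$\gamma_3(f,\xi)=\max\Big(1,\ \sup_{k\ge2}\Big\|D\hat f(\xi)^{-1}\tfrac{D^k\hat f(\xi)}{k!}\Big\|^{\frac1{k-1}},\ \sup_{k\ge2}\Big\|\tfrac{1}{\Delta_3(f_n)}\tfrac{D^kf_n(\xi)}{k!}\Big\|^{\frac1{k-1}}\Big).$$ Modified Newton iteration for simple triple zeros: for a point $p$ let $$L_3(f_n)(p)=\frac16\frac{\partial^3f_n(p)}{\partial X_1^3}-\frac{\partial^2f_n(p)}{\partial X_1\partial\hat X}\cdot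 D\hat f(p)^{-1}\frac12\frac{\partial^2\hat f(p)}{\partial X_1^2},$$ $$\Gamma_1(f_n)(p)=\frac16\frac{\partial^2f_n(p)}{\partial X_1^2}-\frac{\partial f_n(p)}{\partial\hat X}\cdot D\hat f(p)^{-1}\frac12\frac{\partial^2\hat f(p)}{\partial X_1^2}.$$ For $z=(z_1,\hat z)$ put $N_1(\hat z)=\hat z-D\hat f(z)^{-1}\hat f(z)$, $\hat y=N_1(\hat z)$, $p=(z_1,\hat y)$, $N_2(z_1)=z_1-L_3(f_n)(p)^{-1}\,\Gamma_1(f_n)(p)$, and $N_f(z)=(N_2(z_1),N_1(\hat z))$. $N_f^k$ is its $k$-fold iterate. Rational functions: $$b_{2,1}(u)=\frac{(1-2u)^2u}{[2(1-2u)^2-1](1-u)},$$ $$a_3(u)=\frac{(2u-1)^4(8u^2-8u+1)}{128u^6-384u^5+464u^4-320u^3+136u^2-30u+1},$$ $$b_{3,3}(u)=\frac{-a_3(u)}{3(2u-1)^4(8u^2-8u+1)^2(u-1)^4}\cdot\big(3072u^{12}-25088u^{11}+92480u^{10}-202336u^9+289640u^8-282020u^7+188614u^6-85997u^5+26342u^4-5368u^3+702u^2-42u\big).$$ *)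

(* Defs.v *)
From HB Require Import structures.
From mathcomp Require Import all_boot all_order all_algebra.
From mathcomp Require Import classical_sets reals exp.
From mathcomp Require Import complex mpoly.

Set Implicit Arguments.
Unset Strict Implicit.
Unset Printing Implicit Defensive.

Import Order.TTheory GRing.Theory Num.Theory.

Local Open Scope ring_scope.

(* Complex numbers are R[i] over an arbitrary realType R.  A system has     *)
(* n = m.+1 equations and variables, so that n - 1 = m.  X_1 has index      *)
(* ord0, X_{j+2} has index lift ord0 j; f_n is f ord_max, and the j-th      *)
(* component of \hat f is f (lift ord_max j), where lift ord_max j has the  *)
(* same value as j.  Points are column vectors, and \hat z is row' ord0 z.  *)

Section SimpleTripleZero.

Variable R : realType.
Local Notation C := R[i].

Definition hnorm (p : nat) (v : 'cV[C]_p) : R :=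
  Num.sqrt (\sum_i (ComplexField.Normc.normc (v i 0)) ^+ 2).

(* Supremum of ||T(v_1, ..., v_k)|| over vectors of norm at most 1. *)
Definition opnorm (n p k : nat) (T : k.-tuple 'cV[C]_n -> 'cV[C]_p) : R :=
  sup [set hnorm (T vs) | vs in
        [set vs : k.-tuple 'cV[C]_n | forall i, hnorm (tnth vs i) <= 1]]%classic.

Definition mev (n : nat) (x : 'cV[C]_n) (p : {mpoly C[n]}) : C :=
  p.@[fun i => x i 0].

Definition dirderiv (n : nat) (v : 'cV[C]_n) (p : {mpoly C[n]}) : {mpoly C[n]} :=
  \sum_i v i 0 *: p^`M(i).

(* The k-linear form D^k p(x) : (v_1, ..., v_k) |-> the sum over i_1, .., i_k *)
(* of v_1[i_1] ... v_k[i_k] d^k p / dX_{i_1} ... dX_{i_k} (x).               *)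
Definition Dk (n k : nat) (p : {mpoly C[n]}) (x : 'cV[C]_n)
    (vs : k.-tuple 'cV[C]_n) : C :=
  mev x (foldr (@dirderiv n) p vs).

Section System.

Variable m : nat.
Implicit Types (f : 'I_m.+1 -> {mpoly C[m.+1]}) (x z xi : 'cV[C]_m.+1).

Definition fhat f (j : 'I_m) : {mpoly C[m.+1]} := f (lift ord_max j).
Definition flast f : {mpoly C[m.+1]} := f ord_max.

Definition Dfhat f x : 'M[C]_m :=
  \matrix_(i, j) mev x (fhat f i)^`M(lift ord0 j).

Definition fhat_at f x : 'cV[C]_m := \col_i mev x (fhat f i).

Definition fhat_11 f x : 'cV[C]_m :=
  \col_i mev x ((fhat f i)^`M(ord0))^`M(ord0).

Definition flast_hat f x : 'rV[C]_m :=
  \row_j mev x (flast f)^`M(lift ord0 j).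

Definition flast_1hat f x : 'rV[C]_m :=
  \row_j mev x ((flast f)^`M(lift ord0 j))^`M(ord0).

(* At x = xi this is Delta_3(f_n). *)
Definition L3 f x : C :=
  6^-1 * mev x (((flast f)^`M(ord0))^`M(ord0))^`M(ord0)
  - (flast_1hat f x *m invmx (Dfhat f x) *m (2^-1 *: fhat_11 f x)) 0 0.

Definition Gamma1 f x : C :=
  6^-1 * mev x ((flast f)^`M(ord0))^`M(ord0)
  - (flast_hat f x *m invmx (Dfhat f x) *m (2^-1 *: fhat_11 f x)) 0 0.

Definition simple_triple_zero f xi : Prop :=
  [/\ forall i, mev xi (f i) = 0,
      Dfhat f xi \in unitmx,
      forall i, mev xi (f i)^`M(ord0) = 0 /\ mev xi (flast f)^`M(i) = 0,
      mev xi ((flast f)^`M(ord0))^`M(ord0) = 0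
    & L3 f xi != 0].

Definition fhat_term f xi (k : nat) : R :=
  opnorm (fun vs : k.-tuple 'cV[C]_m.+1 =>
    (k`!)%:R^-1 *: (invmx (Dfhat f xi) *m \col_i Dk (fhat f i) xi vs)).

(* The scalar-valued form is viewed with values in 1 x 1 matrices. *)
Definition flast_term f xi (k : nat) : R :=
  opnorm (fun vs : k.-tuple 'cV[C]_m.+1 =>
    ((L3 f xi)^-1 * ((k`!)%:R^-1 * Dk (flast f) xi vs))%:M : 'cV[C]_1).

Definition gamma3 f xi : R :=
  Num.max 1 (Num.max
    (sup [set fhat_term f xi k `^ (k.-1)%:R^-1 | k in [set k | (2 <= k)%N]]%classic)
    (sup [set flast_term f xi k `^ (k.-1)%:R^-1 | k in [set k | (2 <= k)%N]]%classic)).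

(* The point (a, v) of C x C^(n-1). *)
Definition join1 (a : C) (v : 'cV[C]_m) : 'cV[C]_m.+1 :=
  col_mx (a%:M : 'cV[C]_1) v.

Definition N1 f z : 'cV[C]_m :=
  row' ord0 z - invmx (Dfhat f z) *m fhat_at f z.

Definition N2 f z : C :=
  let p := join1 (z ord0 0) (N1 f z) in
  z ord0 0 - (L3 f p)^-1 * Gamma1 f p.

Definition Nf f z : 'cV[C]_m.+1 := join1 (N2 f z) (N1 f z).

End System.

(* All poles of b21, a3 and b33 on the positive half-line exceed 0.03, so    *)
(* the convention x / 0 = 0 does not affect solutions below that value.     *)
Definition b21 (u : R) : R :=
  (1 - 2 * u) ^+ 2 * u / ((2 * (1 - 2 * u) ^+ 2 - 1) * (1 - u)).

Definition a3 (u : R) : R :=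
  (2 * u - 1) ^+ 4 * (8 * u ^+ 2 - 8 * u + 1)
  / (128 * u ^+ 6 - 384 * u ^+ 5 + 464 * u ^+ 4 - 320 * u ^+ 3
     + 136 * u ^+ 2 - 30 * u + 1).

Definition b33 (u : R) : R :=
  - a3 u
  / (3 * (2 * u - 1) ^+ 4 * (8 * u ^+ 2 - 8 * u + 1) ^+ 2 * (u - 1) ^+ 4)
  * (3072%:R * u ^+ 12 - 25088%:R * u ^+ 11 + 92480%:R * u ^+ 10 - 202336%:R * u ^+ 9
     + 289640%:R * u ^+ 8 - 282020%:R * u ^+ 7 + 188614%:R * u ^+ 6 - 85997%:R * u ^+ 5
     + 26342%:R * u ^+ 4 - 5368%:R * u ^+ 3 + 702 * u ^+ 2 - 42 * u).

Definition smallest_positive_solution (F : R -> R) (c u : R) : Prop :=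
  [/\ 0 < u, F u = c & forall t, 0 < t -> F t = c -> u <= t].

End SimpleTripleZero.

(* Main.v *)
Require Import Defs.
From HB Require Import structures.
From mathcomp Require Import all_boot all_order all_algebra.
From mathcomp Require Import classical_sets reals exp.
From mathcomp Require Import complex mpoly.
From mathcomp Require boolp.
From mathcomp Require Import ring lra zify.

(** Write g for D\hat f(xi)^-1 \hat f, h for f_n / Delta_3(f_n), gamma for
    gamma_3(f, xi), d for ||z - xi|| and u for gamma^3 d.  The definition of
    gamma says that the Taylor coefficients D^k g(xi) / k! and D^k h(xi) / k!
    with k >= 2 have norm at most gamma^(k-1) (lemma [gamma_jet_le]), so every
    quantity occurring in the iteration is, as a function of the displacement x
    from xi, dominated by a geometric series in q = gamma ||x||.  Two estimates
    carry the argument.  [jet_variation] bounds the change of an iterated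
    derivative between xi and xi + x by a multiple of q.  [euler_defect] bounds
    Phi'(xi + x) a - Phi(xi + x) for Phi(xi) = 0 and x = a + b: the linear terms
    in a cancel, and what is left is - Phi'(xi) b up to terms of second order in
    x.  This cancellation is the reason for the quadratic convergence of any
    iteration of Newton type.

    Applied to g, with a the last n - 1 coordinates of z - xi, it shows that
    y = N_1(\hat z) - \hat xi has norm at most 1.1 gamma d^2
    ([newton_hat_step]); the term in b vanishes because g has no linear term in
    X_1.  At the intermediate point p = (z_1, N_1(\hat z)), let L and Gamma be
    L_3(f_n)(p) and Gamma_1(f_n)(p), both divided by Delta_3(f_n).  With a now
    standing for z_1 - xi_1, the new first coordinate has error
    a - L^-1 Gamma = L^-1 (a L - Gamma).  Here L is close to its value 1 at xi
    ([L_jet_near1]), and a L - Gamma is a combination of two defects of the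
    kind above, taken for second and first derivatives of h, so that it is of
    order gamma^2 (||y|| + gamma d^2) ([L_jet_Gamma_jet_defect]).  Altogether
    ||N_f(z) - xi|| <= 22 u d as soon as u <= 0.02225 ([Nf_quadratic]).

    On [0, 9/400] the numerators of b_{2,1} and b_{3,3} increase and their
    denominators decrease and stay positive, hence F = 2 b_{2,1}^2 + 2 b_{3,3}^2
    is strictly increasing there ([thresholdF_incr]).  Clearing denominators,
    the intermediate value theorem for polynomials gives the solutions u_3 and
    u_3' between explicit rationals, and monotonicity makes them the smallest
    ones.  In particular both are below 0.02225, where 22 u < 1/2.  So one step
    at least halves the error, and iterating the quadratic bound yields the
    exponents 2^k - 1 ([iterates_quadratic]). *)

Set Implicit Arguments.
Unset Strict Implicit.
Unset Printing Implicit Defensive.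

Import Order.TTheory GRing.Theory Num.Theory.
Local Open Scope ring_scope.

Local Notation normc := ComplexField.Normc.normc.

(** * The Hermitian norm *)

Section HermitianNorm.
Variable R : realType.
Local Notation C := R[i].

Lemma normc_ge0 (x : C) : 0 <= normc x.
Proof. by case: x => a b; rewrite sqrtr_ge0. Qed.

Lemma normc_real (a : R) : 0 <= a -> normc a%:C%C = a.
Proof. by move=> a0; rewrite /= expr0n /= addr0 sqrtr_sqr ger0_norm. Qed.

Lemma normc_nat k : normc (k%:R : C) = k%:R.
Proof. by rewrite -(normc_real (ler0n R k)) rmorph_nat. Qed.

(** The quadratic polynomial sum_i (t a_i + b_i)^2 is nonnegative at its minimiser
    t = - S / A. *)
Lemma cauchy_schwarz n (a b : 'I_n -> R) :
  (\sum_i a i * b i) ^+ 2 <= (\sum_i a i ^+ 2) * (\sum_i b i ^+ 2).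
Proof.
pose A := \sum_i a i ^+ 2; pose B := \sum_i b i ^+ 2; pose S := \sum_i a i * b i.
rewrite -/A -/B -/S.
have H t : 0 <= A * t ^+ 2 + 2 * S * t + B.
  have -> : A * t ^+ 2 + 2 * S * t + B = \sum_i (t * a i + b i) ^+ 2.
    rewrite mulr_sumr !mulr_suml -!big_split /=; apply: eq_bigr => i _; ring.
  by apply: sumr_ge0 => i _; rewrite sqr_ge0.
have A0 : 0 <= A by apply: sumr_ge0 => i _; rewrite sqr_ge0.
have [A1|A1] := eqVneq A 0.
  have h i : a i = 0.
    have /psumr_eq0P h0 : \sum_i a i ^+ 2 = 0 := A1.
    by apply/eqP; rewrite -sqrf_eq0 h0// => j _; rewrite sqr_ge0.
  by rewrite /S big1 ?A1 ?mul0r ?expr0n // => i _; rewrite h mul0r.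
have := H (- S / A); have Ap : 0 < A by rewrite lt_def A1.
have -> : A * (- S / A) ^+ 2 + 2 * S * (- S / A) + B = (A * B - S ^+ 2) / A by field.
by rewrite pmulr_lge0 ?invr_gt0// subr_ge0.
Qed.

Lemma hnorm_ge0 n (v : 'cV[C]_n) : 0 <= hnorm v.
Proof. exact: sqrtr_ge0. Qed.

Lemma sqr_hnorm n (v : 'cV[C]_n) : hnorm v ^+ 2 = \sum_i normc (v i 0) ^+ 2.
Proof. by rewrite sqr_sqrtr// sumr_ge0// => i _; rewrite sqr_ge0. Qed.

Lemma hnorm0 n : hnorm (0 : 'cV[C]_n) = 0.
Proof.
rewrite /hnorm big1 ?sqrtr0// => i _.
by rewrite mxE ComplexField.Normc.normc0 expr0n.
Qed.

Lemma hnorm_eq0 n (v : 'cV[C]_n) : hnorm v = 0 -> v = 0.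
Proof.
move=> v0; apply/matrixP => i j; rewrite ord1 mxE.
have : \sum_i normc (v i 0) ^+ 2 = 0 by rewrite -sqr_hnorm v0 expr0n.
move=> /psumr_eq0P h; apply: ComplexField.Normc.eq0_normc.
by apply/eqP; rewrite -sqrf_eq0; apply/eqP/h => // k _; rewrite sqr_ge0.
Qed.

Lemma hnormZ n (c : C) (v : 'cV[C]_n) : hnorm (c *: v) = normc c * hnorm v.
Proof.
apply/eqP; rewrite -(@eqrXn2 _ 2) ?mulr_ge0 ?hnorm_ge0 ?normc_ge0//.
rewrite exprMn !sqr_hnorm mulr_sumr; apply/eqP; apply: eq_bigr => i _.
by rewrite mxE ComplexField.Normc.normcM exprMn.
Qed.

Lemma hnormN n (v : 'cV[C]_n) : hnorm (- v) = hnorm v.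
Proof. by congr Num.sqrt; apply: eq_bigr => i _; rewrite mxE normcN. Qed.

Lemma hnormD n (v w : 'cV[C]_n) : hnorm (v + w) <= hnorm v + hnorm w.
Proof.
have [hv hw] := (hnorm_ge0 v, hnorm_ge0 w).
rewrite -(@ler_pXn2r _ 2) ?nnegrE ?addr_ge0 ?hnorm_ge0//.
apply: (@le_trans _ _ (\sum_i (normc (v i 0) + normc (w i 0)) ^+ 2)).
  rewrite sqr_hnorm; apply: ler_sum => i _.
  by rewrite ler_pXn2r ?nnegrE ?addr_ge0 ?normc_ge0// mxE le_normcD.
under eq_bigr do rewrite sqrrD; rewrite sqrrD !big_split /= -!sqr_hnorm.
rewrite lerD2r lerD2l mulr2n; apply: lerD => /=;
  rewrite -(@ler_pXn2r _ 2) ?nnegrE ?mulr_ge0 ?sumr_ge0// ?exprMn ?sqr_hnorm ?cauchy_schwarz// => i _;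
    by rewrite mulr_ge0 ?normc_ge0.
Qed.

Lemma hnormB n (v w : 'cV[C]_n) : hnorm (v - w) <= hnorm v + hnorm w.
Proof. by rewrite -(hnormN w) hnormD. Qed.

Lemma hnorm_sum (I : Type) (r : seq I) (P : pred I) n (E : I -> 'cV[C]_n) :
  hnorm (\sum_(i <- r | P i) E i) <= \sum_(i <- r | P i) hnorm (E i).
Proof.
elim/big_ind2: _ => [|a a' b b' ha hb|//]; first by rewrite hnorm0.
by rewrite (le_trans (hnormD _ _))// lerD.
Qed.

Lemma normc_le_hnorm n (v : 'cV[C]_n) i : normc (v i 0) <= hnorm v.
Proof.
rewrite -(@ler_pXn2r _ 2) ?nnegrE ?hnorm_ge0 ?normc_ge0// sqr_hnorm.
by rewrite (bigD1 i)//= lerDl sumr_ge0// => j _; rewrite sqr_ge0.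
Qed.

Lemma hnorm_cV1 (v : 'cV[C]_1) : hnorm v = normc (v 0 0).
Proof. by rewrite /hnorm big_ord1 sqrtr_sqr ger0_norm ?normc_ge0. Qed.

(** Zero is included: there the unit direction may be taken to be 0.  Multilinear
    bounds on the unit ball extend to all vectors through this factorisation. *)
Lemma hnorm_unit_factor n (v : 'cV[C]_n) :
  exists2 w, hnorm w <= 1 & v = (hnorm v)%:C%C *: w.
Proof.
have [v0|v0] := eqVneq (hnorm v) 0.
  by exists 0; rewrite ?hnorm0 // scaler0 (hnorm_eq0 v0).
exists ((hnorm v)^-1%:C%C *: v).
  by rewrite hnormZ normc_real ?invr_ge0 ?hnorm_ge0// mulVf.
by rewrite scalerA -rmorphM /= divff // scale1r.
Qed.

Variable m : nat.

Lemma join1_ord0 (a : C) (v : 'cV[C]_m) : join1 a v ord0 0 = a.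
Proof.
have -> : ord0 = lshift m (ord0 : 'I_1) by apply/val_inj.
by rewrite /join1 (col_mxEu (a%:M : 'cV_1)) mxE mulr1n.
Qed.

Lemma join1_lift (a : C) (v : 'cV[C]_m) j : join1 a v (lift ord0 j) 0 = v j 0.
Proof.
have -> : lift ord0 j = rshift 1 j by apply/val_inj.
by rewrite /join1 (col_mxEd (a%:M : 'cV_1)).
Qed.

Lemma join1P (x y : 'cV[C]_m.+1) :
  x ord0 0 = y ord0 0 -> (forall j, x (lift ord0 j) 0 = y (lift ord0 j) 0) -> x = y.
Proof.
move=> h0 h1; apply/matrixP => i j; rewrite ord1.
by case: (unliftP ord0 i) => [k ->|->].
Qed.

Lemma join1K (x : 'cV[C]_m.+1) : join1 (x ord0 0) (row' ord0 x) = x.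
Proof. by apply: join1P => [|j]; rewrite ?join1_ord0 ?join1_lift ?mxE. Qed.

Lemma join1D (a b : C) (v w : 'cV[C]_m) : join1 (a + b) (v + w) = join1 a v + join1 b w.
Proof. by apply: join1P => [|j]; rewrite [RHS]mxE ?join1_ord0 ?join1_lift ?mxE. Qed.

Lemma join1Z c (a : C) (v : 'cV[C]_m) : join1 (c * a) (c *: v) = c *: join1 a v.
Proof. by apply: join1P => [|j]; rewrite [RHS]mxE ?join1_ord0 ?join1_lift ?mxE. Qed.

Lemma join1N (a : C) (v : 'cV[C]_m) : join1 (- a) (- v) = - join1 a v.
Proof. by rewrite -[RHS]scaleN1r -join1Z mulN1r scaleN1r. Qed.

Lemma sqr_hnorm_join1 (a : C) (v : 'cV[C]_m) :
  hnorm (join1 a v) ^+ 2 = normc a ^+ 2 + hnorm v ^+ 2.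
Proof.
rewrite !sqr_hnorm big_ord_recl join1_ord0; congr (_ + _).
by apply: eq_bigr => i _; rewrite join1_lift.
Qed.

Lemma hnorm_join10 (a : C) : hnorm (join1 a (0 : 'cV[C]_m)) = normc a.
Proof.
apply/eqP; rewrite -(@eqrXn2 _ 2) ?hnorm_ge0 ?normc_ge0//.
by rewrite sqr_hnorm_join1 hnorm0 expr0n addr0.
Qed.

Lemma hnorm_join01 (v : 'cV[C]_m) : hnorm (join1 0 v) = hnorm v.
Proof.
apply/eqP; rewrite -(@eqrXn2 _ 2) ?hnorm_ge0//.
by rewrite sqr_hnorm_join1 ComplexField.Normc.normc0 expr0n add0r.
Qed.

End HermitianNorm.

(** * Directional derivatives and Taylor expansion *)

Section Derivatives.
Variables (R : realType) (n : nat).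
Local Notation C := R[i].
Implicit Types (q : {mpoly C[n]}) (x v w : 'cV[C]_n) (vs : seq 'cV[C]_n).

Lemma dirderiv_is_linear v : linear (dirderiv v).
Proof.
move=> c p q; rewrite /dirderiv scaler_sumr -big_split /=; apply: eq_bigr => i _.
by rewrite mderivD mderivZ scalerDr !scalerA mulrC.
Qed.

HB.instance Definition _ v :=
  GRing.isLinear.Build C {mpoly C[n]} {mpoly C[n]} _ (dirderiv v)
    (dirderiv_is_linear v).

Lemma dirderiv_linearl c v w q :
  dirderiv (c *: v + w) q = c *: dirderiv v q + dirderiv w q.
Proof.
rewrite /dirderiv scaler_sumr -big_split /=; apply: eq_bigr => i _.
by rewrite !mxE scalerA -scalerDl.
Qed.

Lemma dirderivM v p q : dirderiv v (p * q) = dirderiv v p * q + p * dirderiv v q.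
Proof.
rewrite /dirderiv mulr_suml mulr_sumr -big_split /=; apply: eq_bigr => i _.
by rewrite mderivM scalerDr scalerAl scalerAr.
Qed.

Lemma dirderivX v i : dirderiv v 'X_i = (v i 0)%:MP.
Proof.
rewrite /dirderiv (bigD1 i)//= big1 => [|j ji].
  rewrite addr0 mderivX mnm1E eqxx scale1r -{1}[U_(i)%MM]addm0 addmC addmK mpolyX0.
  by rewrite -mul_mpolyC mulr1.
by rewrite mderivX mnm1E eq_sym (negbTE ji) scale0r scaler0.
Qed.

Lemma msize_dirderiv v q : (msize (dirderiv v q) <= (msize q).-1)%N.
Proof.
apply: leq_trans (msize_sum _ _ _) _; apply/bigmax_leqP => i _.
apply: leq_trans (msizeZ_le _ _) _.
rewrite /mderiv big_seq; apply: leq_trans (msize_sum _ _ _) _.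
apply/bigmax_leqP_seq => k kq _.
have [->|ki] := eqVneq (k i) 0%N; first by rewrite mul0r scale0r msize0.
apply: leq_trans (msizeZ_le _ _) _; rewrite msizeX.
have := msize_mdeg_lt kq; rewrite -[X in mdeg X](@submK _ U_(i)) ?lep1mP//.
by rewrite mdegD mdeg1; case: (msize q) => // s; rewrite addn1.
Qed.

Lemma foldr_dirderiv_eq0 q vs : (msize q <= size vs)%N -> foldr (@dirderiv R n) q vs = 0.
Proof.
suff H : (msize (foldr (@dirderiv R n) q vs) <= msize q - size vs)%N.
  rewrite -subn_eq0 => /eqP h; apply/eqP; rewrite -msize_poly_eq0 -leqn0.
  by rewrite -[X in (_ <= X)%N]h.
elim: vs => [|v vs IH] /=; first by rewrite subn0.
by apply: leq_trans (msize_dirderiv _ _) _; rewrite subnS; lia.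
Qed.

(** The polynomial q(x + t v) in the variable t. *)
Definition restrict_line x v : {mpoly C[n]} -> {poly C} :=
  mmap (@polyC C) (fun i => (x i 0)%:P + (v i 0) *: 'X).

Lemma horner_restrict_line x v q t : (restrict_line x v q).[t] = mev (x + t *: v) q.
Proof.
rewrite /mev mevalE horner_sum; apply: eq_bigr => k _.
rewrite hornerM hornerC horner_prod; congr (_ * _); apply: eq_bigr => i _.
by rewrite horner_exp !hornerE !mxE mulrC.
Qed.

(** Chain rule.  Both sides obey the Leibniz rule, so it is enough to compare
    them on constants and on the variables. *)
Lemma deriv_restrict_line x v q :
  (restrict_line x v q)^`() = restrict_line x v (dirderiv v q).
Proof.
pose P q := (restrict_line x v q)^`() = restrict_line x v (dirderiv v q).
have PM p1 p2 : P p1 -> P p2 -> P (p1 * p2).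
  rewrite /P /restrict_line => h1 h2.
  by rewrite dirderivM mmapD !rmorphM /= derivM h1 h2.
have PC c : P c%:MP.
  rewrite /P /restrict_line mmapC derivC /dirderiv big1 ?mmap0// => i _.
  by rewrite mderivC scaler0.
have PX i : P 'X_i.
  by rewrite /P dirderivX /restrict_line mmapX mmap1U mmapC derivD derivC derivZ derivX add0r alg_polyC.
have PXm k : P 'X_[k].
  rewrite mpolyXE_id; apply: (big_ind P) => [||i _]; [exact: PC|exact: PM|].
  elim: (k i) => [|l IH]; first exact: PC.
  by rewrite exprS; exact: (PM _ _ (PX i) IH).
rewrite -/(P q); elim/mpolyind: q => [|c k p _ _ Pp].
  by rewrite /P linear0 /restrict_line mmap0 deriv0.
rewrite /P linearD linearZ /restrict_line !mmapD !mmapZ derivD deriv_mulC.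
by congr (_ * _ + _); [exact: PXm|exact: Pp].
Qed.

(** Taylor's formula for the univariate polynomial q(x + t v), read at t = 1. *)
Lemma taylor x v q N : (msize q <= N)%N ->
  mev (x + v) q
  = \sum_(k < N) (k`!)%:R^-1 * mev x (foldr (@dirderiv R n) q (nseq k v)).
Proof.
move=> qN; set phi := restrict_line x v q.
have phiE k : phi`_k = (k`!)%:R^-1 * mev x (foldr (@dirderiv R n) q (nseq k v)).
  have -> : mev x (foldr (@dirderiv R n) q (nseq k v)) = phi^`(k).[0].
    have -> : phi^`(k) = restrict_line x v (foldr (@dirderiv R n) q (nseq k v)).
      by elim: k => // k IH; rewrite derivnS IH deriv_restrict_line.
    by rewrite horner_restrict_line scale0r addr0.
  rewrite horner_coef0 coef_derivn addn0 ffactnn -[phi`_k *+ _]mulr_natl mulrA.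
  by rewrite mulVf ?mul1r// pnatr_eq0 -lt0n fact_gt0.
rewrite -[v]scale1r -horner_restrict_line scale1r -/phi (@horner_coef_wide _ N).
  by apply: eq_bigr => k _; rewrite expr1n mulr1 phiE.
apply/leq_sizeP => k Nk; rewrite phiE foldr_dirderiv_eq0 ?size_nseq ?(leq_trans qN)//.
by rewrite /mev meval0 mulr0.
Qed.

(** The vector of derivatives D^k F(x)(v_1, ..., v_k) of a family F of polynomials;
    directions are kept in a list, so that the Taylor expansion of a derivative is
    again made of jets, with nseq k x prepended to the list. *)
Definition jet p (F : 'I_p -> {mpoly C[n]}) x vs : 'cV[C]_p :=
  \col_i mev x (foldr (@dirderiv R n) (F i) vs).

Lemma jet_slot p (F : 'I_p -> {mpoly C[n]}) x s c v w t :
  jet F x (s ++ (c *: v + w) :: t) = c *: jet F x (s ++ v :: t) + jet F x (s ++ w :: t).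
Proof.
apply/colP => i; rewrite !mxE /mev !foldr_cat /= dirderiv_linearl.
rewrite -mevalZ -mevalD; congr (_.@[_]).
by elim: s => //= u s ->; rewrite linearP.
Qed.

Lemma jet0 p (F : 'I_p -> {mpoly C[n]}) x s t : jet F x (s ++ 0 :: t) = 0.
Proof.
have := jet_slot F x s 1 0 0 t; rewrite !scale1r addr0 => /eqP.
by rewrite -subr_eq0 opprD addNKr oppr_eq0 => /eqP.
Qed.

Lemma jetZ p (F : 'I_p -> {mpoly C[n]}) x s c v t :
  jet F x (s ++ (c *: v) :: t) = c *: jet F x (s ++ v :: t).
Proof. by rewrite -[c *: v]addr0 jet_slot jet0 addr0. Qed.

Lemma jetB p (F : 'I_p -> {mpoly C[n]}) x s v w t :
  jet F x (s ++ (v - w) :: t) = jet F x (s ++ v :: t) - jet F x (s ++ w :: t).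
Proof. by rewrite addrC -scaleN1r jet_slot scaleN1r addrC. Qed.

Lemma jet_comb p r (B : 'M[C]_(p, r)) (F : 'I_r -> {mpoly C[n]}) x vs :
  jet (fun i => \sum_j B i j *: F j) x vs = B *m jet F x vs.
Proof.
apply/colP => i; rewrite !mxE /mev.
have -> : foldr (@dirderiv R n) (\sum_j B i j *: F j) vs
        = \sum_j B i j *: foldr (@dirderiv R n) (F j) vs.
  elim: vs => //= v vs ->; rewrite linear_sum; apply: eq_bigr => j _; exact: linearZ.
by rewrite raddf_sum; apply: eq_bigr => j _; rewrite mxE /= mevalZ.
Qed.

(** Iterated derivatives of at least this order are zero, which makes the Taylor
    expansions finite sums and gamma_3 a maximum. *)
Definition jet_order_bound p (F : 'I_p -> {mpoly C[n]}) := (\max_i msize (F i))%N.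

Lemma jet_eq0 p (F : 'I_p -> {mpoly C[n]}) x vs :
  (jet_order_bound F <= size vs)%N -> jet F x vs = 0.
Proof.
move=> h; apply/colP => i; rewrite !mxE foldr_dirderiv_eq0 ?/mev ?meval0//.
by apply: leq_trans h; apply: leq_bigmax.
Qed.

Lemma jet_taylor p (F : 'I_p -> {mpoly C[n]}) x v ws N :
  (jet_order_bound F <= N)%N ->
  jet F (x + v) ws = \sum_(k < N) (k`!)%:R^-1 *: jet F x (nseq k v ++ ws).
Proof.
move=> h; apply/colP => i; rewrite summxE mxE (@taylor _ _ _ N).
  by apply: eq_bigr => k _; rewrite !mxE foldr_cat.
suff : (msize (foldr (@dirderiv R n) (F i) ws) <= msize (F i))%N.
  move=> /leq_trans -> //; apply: leq_trans h; exact: leq_bigmax.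
elim: ws => //= w ws; apply: leq_trans.
by apply: leq_trans (msize_dirderiv _ _) (leq_pred _).
Qed.

(** This makes the suprema defining the operator norms meaningful.  A derivative
    along v is a combination, with coefficients of modulus at most 1, of the partial
    derivatives, whence the induction on the order. *)
Lemma jet_bounded p (F : 'I_p -> {mpoly C[n]}) x k :
  exists K, forall vs, size vs = k -> (forall v, v \in vs -> hnorm v <= 1) ->
    hnorm (jet F x vs) <= K.
Proof.
elim: k F => [|k IH] F.
  by exists (hnorm (jet F x [::])) => vs /size0nil ->.
have /fin_all_exists [K HK] : forall j : 'I_n, exists K, forall vs, size vs = k ->
    (forall v, v \in vs -> hnorm v <= 1) ->
    hnorm (jet (fun i => (F i)^`M(j)) x vs) <= K by move=> j; apply: IH.
exists (\sum_j K j) => vs; case/lastP: vs => // vs v; rewrite size_rcons => -[szvs] hvs.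
have -> : jet F x (rcons vs v) = \sum_j v j 0 *: jet (fun i => (F i)^`M(j)) x vs.
  apply/colP => i; rewrite summxE mxE /mev foldr_rcons.
  have -> : foldr (@dirderiv R n) (dirderiv v (F i)) vs
          = \sum_j v j 0 *: foldr (@dirderiv R n) ((F i)^`M(j)) vs.
    elim: {szvs hvs} vs => //= w vs ->; rewrite linear_sum.
    by apply: eq_bigr => j _; exact: linearZ.
  by rewrite raddf_sum; apply: eq_bigr => j _; rewrite !mxE /= mevalZ.
apply: le_trans (hnorm_sum _ _ _) _; apply: ler_sum => j _; rewrite hnormZ.
rewrite -[K j]mul1r ler_pM ?normc_ge0 ?hnorm_ge0//.
  by apply: le_trans (normc_le_hnorm _ _) (hvs _ _); rewrite mem_rcons mem_head.
by apply: HK => // w wvs; apply: hvs; rewrite mem_rcons inE wvs orbT.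
Qed.

Lemma jet_homogeneous_bound p (F : 'I_p -> {mpoly C[n]}) x k K :
  (forall vs, size vs = k -> (forall v, v \in vs -> hnorm v <= 1) ->
    hnorm (jet F x vs) <= K) ->
  forall vs, size vs = k -> hnorm (jet F x vs) <= K * \prod_(v <- vs) hnorm v.
Proof.
move=> HK; suff H t : forall s, (size s + size t)%N = k ->
    (forall v, v \in s -> hnorm v <= 1) ->
    hnorm (jet F x (s ++ t)) <= K * \prod_(v <- t) hnorm v.
  by move=> vs szvs; apply: (H vs [::]).
elim: t => [|v t IH] s /= szst hs.
  by rewrite cats0 big_nil mulr1; apply: HK => //; rewrite -szst addn0.
have [w w1 vE] := hnorm_unit_factor v.
rewrite {1}vE jetZ hnormZ normc_real ?hnorm_ge0// big_cons mulrCA.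
rewrite ler_wpM2l ?hnorm_ge0// -cat_rcons; apply: IH.
  by rewrite size_rcons -szst addSnnS.
by move=> u; rewrite mem_rcons inE => /predU1P[->|/hs].
Qed.

End Derivatives.

(** * Geometric majorants for Taylor expansions *)

(** Successive coefficients have ratio (k+1+j) / (k+1), which is at most j + 1. *)
Lemma bin_le_exp k j : ('C(k + j, k) <= j.+1 ^ k)%N.
Proof.
elim: k => [|k IH]; first by rewrite bin0.
rewrite -(@leq_pmul2l k.+1)// -mul_bin_diag /=.
apply: (@leq_trans ((k.+1 + j) * j.+1 ^ k)); first by rewrite leq_mul.
by rewrite expnS mulnA leq_mul//; nia.
Qed.

(** Equality at k = 0; afterwards the ratio of successive left-hand sides is
    (k+3+j)(k+2) / ((k+3)(k+1)), which is at most j + 2. *)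
Lemma bin_mul_le_exp k j : ('C(k.+2 + j, k.+2) * k.+1 <= 'C(j.+2, 2) * j.+2 ^ k)%N.
Proof.
elim: k => [|k IH]; first by rewrite !muln1 addnC addn2.
rewrite -(@leq_pmul2l k.+3)// mulnA -mul_bin_diag /=.
rewrite -(leq_pmul2l (ltn0Sn k)).
apply: (@leq_trans ((k.+3 + j) * k.+2 * ('C(j.+2, 2) * j.+2 ^ k))).
  rewrite (_ : (_ * _)%N = (k.+3 + j) * k.+2 * ('C(k.+2 + j, k.+2) * k.+1))%N; last by ring.
  by rewrite leq_mul.
rewrite expnS (_ : (k.+1 * _)%N = k.+1 * k.+3 * j.+2 * ('C(j.+2, 2) * j.+2 ^ k))%N; last by ring.
by rewrite leq_mul//; nia.
Qed.

Section JetBounds.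
Variables (R : realType) (n p : nat).
Local Notation C := R[i].
Variables (F : 'I_p -> {mpoly C[n]}) (xi : 'cV[C]_n) (gamma : R).
Hypothesis gamma_ge0 : 0 <= gamma.
Hypothesis jet_le : forall vs, (2 <= size vs)%N ->
  hnorm (jet F xi vs) <= (size vs)`!%:R * gamma ^+ (size vs).-1 * \prod_(v <- vs) hnorm v.
Implicit Types (x v w : 'cV[C]_n) (vs ws : seq 'cV[C]_n).

Lemma geometric_sum_le (r : R) N : 0 <= r < 1 -> \sum_(k < N) r ^+ k <= (1 - r)^-1.
Proof.
move=> /andP[r0 r1]; have h : 0 < 1 - r by rewrite subr_gt0.
rewrite -(ler_pM2l h) divff ?gt_eqF// -opprB mulNr -subrX1 opprB.
by rewrite lerBlDr lerDl exprn_ge0.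
Qed.

Lemma natr_fact_addn k j :
  ((k + j)`!)%:R = 'C(k + j, k)%:R * k`!%:R * j`!%:R :> R.
Proof. by rewrite -!natrM -mulnA -{1}(bin_fact (leq_addr j k)) addKn. Qed.

Lemma jet_nseq_le k x ws : (2 <= k + size ws)%N ->
  hnorm (jet F xi (nseq k x ++ ws))
  <= (k + size ws)`!%:R * gamma ^+ (k + size ws).-1
     * (hnorm x ^+ k * \prod_(w <- ws) hnorm w).
Proof.
move=> h2; have := @jet_le (nseq k x ++ ws).
rewrite size_cat size_nseq big_cat /= big_nseq => /(_ h2).
have -> // : iter k ( *%R (hnorm x)) 1 = hnorm x ^+ k.
by elim: (k) => //= k' ->; rewrite exprS.
Qed.

Lemma jet_taylor_term_le k x ws : (2 <= k + size ws)%N ->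
  hnorm ((k`!)%:R^-1 *: jet F xi (nseq k x ++ ws))
  <= (size ws)`!%:R * gamma ^+ (k + size ws).-1 * hnorm x ^+ k
     * \prod_(w <- ws) hnorm w * 'C(k + size ws, k)%:R.
Proof.
move=> h2; have fk : 0 < (k`!)%:R :> R by rewrite ltr0n fact_gt0.
rewrite hnormZ ComplexField.Normc.normcV normc_nat ler_pdivrMl//.
apply: le_trans (jet_nseq_le _ h2) _.
rewrite natr_fact_addn.
set b := 'C(_, _)%:R; set P := \prod_(_ <- _) _; rewrite le_eqVlt; apply/orP; left.
by apply/eqP; ring.
Qed.

(** The term of degree k in the expansion is at most
    j! gamma^(j-1) C(k+j, j) q^k times the norms of ws, and C(k+j, j) <= (j+1)^k
    turns the sum over k >= 1 into a geometric series. *)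
Lemma jet_variation x ws (q := gamma * hnorm x) (j := size ws) :
  (0 < j)%N -> j.+1%:R * q < 1 ->
  hnorm (jet F (xi + x) ws - jet F xi ws)
  <= j`!%:R * gamma ^+ j.-1 * \prod_(w <- ws) hnorm w
     * (j.+1%:R * q / (1 - j.+1%:R * q)).
Proof.
move=> j0 q1; have q0 : 0 <= q by rewrite mulr_ge0 ?hnorm_ge0.
rewrite (@jet_taylor _ _ _ _ _ _ _ (jet_order_bound F).+1) //.
rewrite big_ord_recl /= fact0 invr1 scale1r addrAC subrr add0r.
apply: le_trans (hnorm_sum _ _ _) _.
set P := \prod_(_ <- _) _; have P0 : 0 <= P by apply: prodr_ge0 => w _; apply: hnorm_ge0.
set r := _ * q; have r0 : 0 <= r by rewrite mulr_ge0.
apply: (@le_trans _ _ (\sum_(k < jet_order_bound F) j`!%:R * gamma ^+ j.-1 * P * r * r ^+ k)).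
  apply: ler_sum => k _; rewrite /bump /= add1n.
  apply: le_trans (@jet_taylor_term_le k.+1 x ws _) _; first by rewrite -/j; lia.
  rewrite -/P -/j.
  have -> : (k.+1 + j).-1 = (j.-1 + k.+1)%N by lia.
  have := bin_le_exp k.+1 j; rewrite -(ler_nat R) natrX => hb.
  apply: (@le_trans _ _ (j`!%:R * gamma ^+ j.-1 * P * q ^+ k.+1 * j.+1%:R ^+ k.+1)).
    rewrite -[X in _ <= X]mulrA [q ^+ _ * _]mulrC mulrA [X in _ <= X]mulrAC.
    rewrite /q exprMn exprD.
    have -> (a b c d e g : R) : a * (b * c) * d * e * g = a * b * e * (c * d) * g by ring.
    apply: ler_wpM2l => //.
    by rewrite !mulr_ge0 ?exprn_ge0 ?hnorm_ge0.
  by rewrite -mulrA -exprMn [q * _]mulrC -/r exprS mulrA.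
rewrite -mulr_sumr [X in _ <= X]mulrA ler_wpM2l ?geometric_sum_le ?r0//.
by rewrite !mulr_ge0 ?exprn_ge0 ?hnorm_ge0.
Qed.

(** With Phi = jet F _ ws, the terms of degree k and k + 1 of the two expansions
    combine into D^(k+1) Phi applied to (x, ..., x, (k+1) a - x), that is, to
    (x, ..., x, k a - b), divided by (k+1)!.  For k = 0 this is the linear term
    in - b, which the third summand on the left removes; the other terms are of
    second order.  The hypothesis on k a - b holds when a and b are orthogonal. *)
Lemma euler_defect x a b ws (q := gamma * hnorm x) (j := size ws) :
  jet F xi ws = 0 -> x = a + b ->
  (forall k, (0 < k)%N -> hnorm (k%:R *: a - b) <= k%:R * hnorm x) ->
  j.+2%:R * q < 1 ->
  hnorm (jet F (xi + x) (a :: ws) - jet F (xi + x) ws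
         + jet F xi (b :: ws))
  <= j`!%:R * gamma ^+ j * \prod_(w <- ws) hnorm w * hnorm x
     * ('C(j.+2, 2)%:R * q / (1 - j.+2%:R * q)).
Proof.
move=> ws0 xE hab q1; have q0 : 0 <= q by rewrite mulr_ge0 ?hnorm_ge0.
set N := jet_order_bound F.
rewrite (@jet_taylor _ _ _ _ _ _ _ N.+1) //.
rewrite (@jet_taylor _ _ _ _ _ _ ws N.+2) // /N; last exact: leqW.
rewrite [X in _ - X]big_ord_recl /= fact0 invr1 scale1r ws0 add0r -sumrB.
have termE (k : 'I_N.+1) : (k`!)%:R^-1 *: jet F xi (nseq k x ++ a :: ws)
   - ((bump 0 k)`!)%:R^-1 *: jet F xi (nseq (bump 0 k) x ++ ws)
   = ((k.+1)`!)%:R^-1 *: jet F xi (nseq k x ++ (k%:R *: a - b) :: ws).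
  rewrite /bump /= add1n.
  have -> : x :: nseq k x ++ ws = nseq k x ++ x :: ws.
    by elim: (nat_of_ord k) => //= k' ->.
  have -> : k%:R *: a - b = k.+1%:R *: a - x.
    by rewrite xE -natr1 scalerDl scale1r opprD addrA addrK.
  rewrite jetB jetZ scalerBr scalerA factS natrM invfM mulrAC mulVf ?mul1r//.
  by rewrite pnatr_eq0.
rewrite (eq_bigr _ (fun k _ => termE k)) big_ord_recl /= invr1 !scale1r scale0r sub0r.
have -> : jet F xi (- b :: ws) = - jet F xi (b :: ws).
  by rewrite -scaleN1r (jetZ F xi [::]) scaleN1r.
rewrite addrAC addNr add0r.
apply: le_trans (hnorm_sum _ _ _) _.
set P := \prod_(_ <- _) _; have P0 : 0 <= P by apply: prodr_ge0 => w _; apply: hnorm_ge0.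
set r := j.+2%:R * q; have r0 : 0 <= r by rewrite mulr_ge0.
apply: (@le_trans _ _ (\sum_(k < N) j`!%:R * gamma ^+ j * P * hnorm x * ('C(j.+2, 2)%:R * q) * r ^+ k)).
  apply: ler_sum => k _; rewrite /bump /= add1n.
  have fk : 0 < (k.+2`!)%:R :> R by rewrite ltr0n fact_gt0.
  rewrite hnormZ ComplexField.Normc.normcV normc_nat ler_pdivrMl// add0n.
  set w := _ - _; have wx : hnorm w <= k.+1%:R * hnorm x by apply: hab.
  apply: le_trans (@jet_nseq_le k.+1 x (w :: ws) _) _ => /=; first by lia.
  rewrite big_cons -/P -/j addnS -addSn natr_fact_addn addnS -addSn.
  have hb : 'C(k.+2 + j, k.+2)%:R * k.+1%:R <= 'C(j.+2, 2)%:R * j.+2%:R ^+ k :> R.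
    by rewrite -natrX -!natrM ler_nat bin_mul_le_exp.
  apply: (@le_trans _ _ ((k.+2)`!%:R * (j`!%:R * gamma ^+ j * P * hnorm x * q ^+ k.+1
                         * ('C(k.+2 + j, k.+2)%:R * k.+1%:R)))).
    set T := 'C(k.+2 + j, k.+2)%:R * (k.+2)`!%:R * j`!%:R * gamma ^+ (k.+1 + j)
             * hnorm x ^+ k.+1 * P.
    rewrite [X in X <= _](_ : _ = T * hnorm w); last by rewrite /T [hnorm w * P]mulrC !mulrA.
    rewrite [X in _ <= X](_ : _ = T * (k.+1%:R * hnorm x)); last first.
      rewrite /T /q exprMn exprD.
      by move: (_`!%:R) (_`!%:R) ('C(_, _)%:R) => c1 c2 c3; ring.
    by apply: ler_wpM2l wx; rewrite !mulr_ge0 ?exprn_ge0 ?hnorm_ge0.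
  apply: ler_wpM2l => //; rewrite /r [(j.+2%:R * q) ^+ k]exprMn [q ^+ k.+1]exprS.
  set T := j`!%:R * gamma ^+ j * P * hnorm x * (q * q ^+ k).
  rewrite [X in _ <= X](_ : _ = T * ('C(j.+2, 2)%:R * j.+2%:R ^+ k)); last first.
    by rewrite /T; move: (_`!%:R) ('C(_, _)%:R) => c1 c2; ring.
  by apply: ler_wpM2l hb; rewrite !mulr_ge0 ?exprn_ge0 ?hnorm_ge0.
rewrite -mulr_sumr [X in _ <= X]mulrA.
rewrite ler_wpM2l ?geometric_sum_le ?r0//.
by rewrite !mulr_ge0 ?exprn_ge0 ?hnorm_ge0.
Qed.

End JetBounds.

(** * The two halves of a Newton step *)

(** The constants of the estimates below, as inequalities between real numbers. *)
Section Arithmetic.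
Variable R : realFieldType.

Lemma newton_hat_arith (q X Y j1 j2 : R) :
  0 <= q -> q <= 89%:R / 4000%:R -> 0 <= X -> 0 <= Y ->
  j1 <= X * (q / (1 - 2 * q)) -> j2 <= 21 / 10 * q * Y -> Y <= j1 + j2 ->
  Y <= 11 / 10 * q * X.
Proof.
move=> q0 q1 X0 Y0 h1 h2 h3.
have D : q / (1 - 2 * q) <= 1047 / 1000 * q by clear -q0 q1; rewrite ler_pdivrMr; nra.
have H2 := ler_wpM2l X0 D; have H3 := ler_wpM2l Y0 q1.
have H4 : Y * (1 - 21 / 10 * q) <= 1047 / 1000 * (q * X) by lra.
have qX := mulr_ge0 q0 X0; clear -H3 H4 qX; lra.
Qed.

Lemma L_jet_near1_arith (gamma q nw d nA nB nD t1 t2 : R) :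
  t1 <= t2 + nD -> t2 <= nA + nB ->
  nA <= 441 / 100 * (gamma ^+ 2 * q) ->
  nB <= 2 * gamma * nw * (323 / 100 * q) -> nD <= 2 * gamma * d ->
  gamma * q * nw <= gamma * q * (113 / 100 * gamma) ->
  gamma * d <= gamma * (561 / 100 * (gamma * q)) -> 0 <= gamma * (gamma * q) ->
  t1 <= 23 * gamma ^+ 2 * q.
Proof. by rewrite expr2; lra. Qed.

Lemma defect_arith (gamma q X Y W nA nB nY1 nY2 t1 t2 t3 : R) :
  t1 <= t2 + nY2 -> t2 <= t3 + nB -> t3 <= nA + nY1 ->
  nA <= 221 / 100 * (gamma ^+ 2 * X * q) ->
  nB <= gamma * W * X * (323 / 100 * q) ->
  nY1 <= gamma ^+ 2 * Y -> nY2 <= 2 * gamma * Y * W ->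
  gamma * (X * q) * W <= gamma * (X * q) * (113 / 100 * gamma) ->
  gamma * Y * W <= gamma * Y * (113 / 100 * gamma) ->
  0 <= gamma * (gamma * (X * q)) -> 0 <= gamma * (gamma * Y) ->
  t1 <= gamma ^+ 2 * (586 / 100 * q * X + 326 / 100 * Y).
Proof. by rewrite expr2; lra. Qed.

Lemma hnorm_w_arith (gamma q nw nw0 t1 t2 t3 : R) :
  nw <= t1 + t2 -> t1 <= nw0 + t3 -> nw0 <= gamma ->
  t3 <= 323 / 100 * (gamma * q) -> t2 <= 21 / 10 * q * nw ->
  gamma * q <= gamma * (23 / 1000) -> nw * q <= nw * (23 / 1000) -> 0 <= gamma ->
  nw <= 113 / 100 * gamma.
Proof. by lra. Qed.

End Arithmetic.

(** Here g and h are any polynomial families with the values at xi of the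
    normalised system D\hat f(xi)^-1 \hat f and f_n / Delta_3(f_n).  The radius
    23 / 1000 for gamma ||x|| leaves room for the intermediate point, which can be
    slightly farther from xi than z. *)
Section NewtonStep.
Variables (R : realType) (m : nat).
Local Notation C := R[i].
Variables (g : 'I_m -> {mpoly C[m.+1]}) (h : 'I_1 -> {mpoly C[m.+1]}).
Variables (xi : 'cV[C]_m.+1) (gamma : R).
Hypothesis gamma_ge1 : 1 <= gamma.
Hypothesis jet_g_le : forall vs, (2 <= size vs)%N ->
  hnorm (jet g xi vs) <= (size vs)`!%:R * gamma ^+ (size vs).-1 * \prod_(v <- vs) hnorm v.
Hypothesis jet_h_le : forall vs, (2 <= size vs)%N ->
  hnorm (jet h xi vs) <= (size vs)`!%:R * gamma ^+ (size vs).-1 * \prod_(v <- vs) hnorm v.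

Local Notation e1 := (join1 1 (0 : 'cV[C]_m)).
Local Notation hat := (@join1 R m 0).

Let gamma_ge0 : 0 <= gamma := le_trans ler01 gamma_ge1.

Lemma join1_hatD (a : C) (v : 'cV[C]_m) : join1 a v = a *: e1 + hat v.
Proof. by rewrite -join1Z mulr1 scaler0 -join1D addr0 add0r. Qed.

Lemma hnorm_e1 : hnorm e1 = 1.
Proof. by rewrite hnorm_join10 ComplexField.Normc.normc1. Qed.

(** The two orthogonal splittings to which [euler_defect] is applied. *)
Lemma hnorm_join1_mulr_le k (a : C) (v : 'cV[C]_m) : (0 < k)%N ->
  hnorm (k%:R *: (a *: e1) - hat v) <= k%:R * hnorm (join1 a v)
  /\ hnorm (k%:R *: hat v - a *: e1) <= k%:R * hnorm (join1 a v).
Proof.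
move=> k0; have k1 : 1 <= k%:R ^+ 2 :> R by rewrite exprn_ege1// ler1n.
have E1 : k%:R *: (a *: e1) - hat v = join1 (k%:R * a) (- v).
  by rewrite -join1N -!join1Z -join1D mulr1 !scaler0 oppr0 addr0 add0r.
have E2 : k%:R *: hat v - a *: e1 = join1 (- a) (k%:R *: v).
  by rewrite -!join1Z -join1N -join1D mulr1 mulr0 !scaler0 oppr0 addr0 add0r.
rewrite E1 E2; split; rewrite -(@ler_pXn2r _ 2) ?nnegrE ?mulr_ge0 ?hnorm_ge0//.
  rewrite exprMn !sqr_hnorm_join1 hnormN ComplexField.Normc.normcM normc_nat exprMn mulrDr.
  by rewrite lerD2l ler_peMl ?sqr_ge0.
rewrite exprMn !sqr_hnorm_join1 normcN hnormZ normc_nat exprMn mulrDr.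
by rewrite lerD2r ler_peMl ?sqr_ge0.
Qed.

Hypothesis g_zero : jet g xi [::] = 0.
Hypothesis g_e1 : jet g xi [:: e1] = 0.
Hypothesis g_hat : forall w, jet g xi [:: hat w] = w.

(** The partial Jacobian of g is the identity at xi, and its variation is
    2 q / (1 - 2 q) <= 2.1 q. *)
Lemma jet_g_hat_near_id x (w : 'cV[C]_m) (q := gamma * hnorm x) : q <= 23 / 1000 ->
  hnorm (jet g (xi + x) [:: hat w] - w) <= 21 / 10 * q * hnorm w.
Proof.
move=> qQ; have q0 : 0 <= q by rewrite mulr_ge0 ?hnorm_ge0.
have := @jet_variation _ _ _ g xi gamma gamma_ge0 jet_g_le x [:: hat w].
rewrite -/q /= => /(_ isT) H; apply: le_trans (_ : _ <= hnorm w * (2 * q / (1 - 2 * q))) _.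
  by move: H; rewrite g_hat expr0 big_seq1 hnorm_join01 (_ : 1`!%:R = 1)// !mul1r; apply; lra.
rewrite mulrC ler_wpM2r ?hnorm_ge0// ler_pdivrMr; nra.
Qed.

Lemma jet_g_hat_inj x (w : 'cV[C]_m) : gamma * hnorm x <= 23 / 1000 ->
  jet g (xi + x) [:: hat w] = 0 -> w = 0.
Proof.
move=> q1 w0; have := @jet_g_hat_near_id x w q1; rewrite w0 sub0r hnormN => H.
apply: hnorm_eq0; apply/eqP; rewrite eq_le hnorm_ge0 andbT.
have q0 : 0 <= gamma * hnorm x by rewrite mulr_ge0 ?hnorm_ge0.
have := hnorm_ge0 w; nra.
Qed.

(** If G is the partial Jacobian at z, then G (v - s) = G v - g(z) is an Euler defect,
    of norm at most ||x|| q / (1 - 2 q), and G is close to the identity. *)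
Lemma newton_hat_step (a : C) (v s : 'cV[C]_m) (x := join1 a v) :
  gamma * hnorm x <= 89%:R / 4000%:R ->
  jet g (xi + x) [:: hat s] = jet g (xi + x) [::] ->
  hnorm (v - s) <= 11 / 10 * (gamma * hnorm x) * hnorm x.
Proof.
set q := gamma * hnorm x => q1 hs; have q0 : 0 <= q by rewrite mulr_ge0 ?hnorm_ge0.
have xE : x = hat v + a *: e1 by rewrite addrC -join1_hatD.
have qQ : q <= 23 / 1000 by lra.
have := @euler_defect _ _ _ g xi gamma gamma_ge0 jet_g_le x (hat v) (a *: e1) [::] g_zero xE.
rewrite -/q /= => H.
have {}H : hnorm (jet g (xi + x) [:: hat (v - s)]) <= hnorm x * (q / (1 - 2 * q)).
  have -> : hat (v - s) = hat v - hat s.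
    by rewrite -join1N -join1D oppr0 addr0.
  rewrite (jetB g _ [::]) hs; move: H; rewrite (jetZ g _ [::]) g_e1.
  rewrite scaler0 addr0 fact0 expr0 big_nil !mul1r; apply; last by lra.
  by move=> k k0; have [] := hnorm_join1_mulr_le a v k0.
have N := @jet_g_hat_near_id x (v - s) qQ.
have T := hnormB (jet g (xi + x) [:: hat (v - s)]) (jet g (xi + x) [:: hat (v - s)] - (v - s)).
rewrite opprB addrC subrK in T.
exact: newton_hat_arith q0 q1 (hnorm_ge0 x) (hnorm_ge0 (v - s)) H N T.
Qed.

(** The value at xi of the vector D\hat f^-1 (1/2) D_11 \hat f that occurs in L_3 and
    Gamma_1. *)
Let w0 := 2^-1 *: jet g xi [:: e1; e1].
Hypothesis h_grad : forall v, jet h xi [:: v] = 0.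
Hypothesis h_11 : jet h xi [:: e1; e1] = 0.
Hypothesis h_delta :
  6^-1 *: jet h xi [:: e1; e1; e1] - jet h xi [:: e1; hat w0] = 1%:M.

Let fact2 : 2`!%:R = 2 :> R. Proof. by []. Qed.
Let fact3 : 3`!%:R = 6 :> R. Proof. by []. Qed.

Let prod_e1e1 : \prod_(u <- [:: e1; e1]) hnorm u = 1.
Proof. by rewrite !big_cons big_nil !hnorm_e1 !mulr1. Qed.

Lemma jet_h_hat2_le (u w : 'cV[C]_m) :
  hnorm (jet h xi [:: hat u; hat w]) <= 2 * gamma * hnorm u * hnorm w.
Proof.
have := @jet_h_le [:: hat u; hat w] isT.
by rewrite !big_cons big_nil !hnorm_join01 /= fact2 expr1 mulr1 mulrA.
Qed.

Lemma jet_h_e1_hat_le (w : 'cV[C]_m) :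
  hnorm (jet h xi [:: e1; hat w]) <= 2 * gamma * hnorm w.
Proof.
have := @jet_h_le [:: e1; hat w] isT.
by rewrite !big_cons big_nil hnorm_join01 hnorm_e1 /= fact2 expr1 mul1r mulr1.
Qed.

Lemma jet_h_hat_e1e1_le (u : 'cV[C]_m) :
  hnorm (jet h xi [:: hat u; e1; e1]) <= 6 * gamma ^+ 2 * hnorm u.
Proof.
have := @jet_h_le [:: hat u; e1; e1] isT.
by rewrite big_cons prod_e1e1 hnorm_join01 /= fact3 mulr1.
Qed.

Lemma hnorm_w0_le : hnorm w0 <= gamma.
Proof.
rewrite /w0 hnormZ ComplexField.Normc.normcV normc_nat.
have := @jet_g_le [:: e1; e1] isT; rewrite prod_e1e1 /= fact2 expr1 mulr1 => H.
by rewrite ler_pdivrMl.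
Qed.

(** The point xi + x with x = (a, y) is the one where L_3 and Gamma_1 are evaluated;
    w is the vector D\hat f^-1 (1/2) D_11 \hat f there. *)
Section AtPoint.
Variables (a : C) (y w : 'cV[C]_m).
Let x := join1 a y.
Let q := gamma * hnorm x.
Hypothesis q_le : q <= 23 / 1000.
Hypothesis w_eq : jet g (xi + x) [:: hat w] = 2^-1 *: jet g (xi + x) [:: e1; e1].

Let q_ge0 : 0 <= q. Proof. by rewrite mulr_ge0 ?hnorm_ge0. Qed.

Let q3_lt1 : 3 * q < 1. Proof. by have := q_le; lra. Qed.
Let q4_lt1 : 4 * q < 1. Proof. by have := q_le; lra. Qed.

Let frac3 : 3 * q / (1 - 3 * q) <= 323 / 100 * q.
Proof. by have := q_ge0; have := q_le; move: q => r r1 r0; rewrite ler_pdivrMr; nra. Qed.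

Let frac4 : 4 * q / (1 - 4 * q) <= 441 / 100 * q.
Proof. by have := q_ge0; have := q_le; move: q => r r1 r0; rewrite ler_pdivrMr; nra. Qed.

Let half_g11_variation :
  hnorm (2^-1 *: jet g (xi + x) [:: e1; e1] - w0) <= 323 / 100 * (gamma * q).
Proof.
rewrite /w0 -scalerBr hnormZ ComplexField.Normc.normcV normc_nat ler_pdivrMl//.
have := @jet_variation _ _ _ g xi gamma gamma_ge0 jet_g_le x [:: e1; e1] isT.
rewrite -/q prod_e1e1 /= fact2 expr1 mulr1 => H; apply: le_trans (H q3_lt1) _.
by have := ler_wpM2l gamma_ge0 frac3; lra.
Qed.

(** From w = w0 + (change of (1/2) D_11 g) - (G - 1) w, with the last term absorbed
    on the left. *)
Lemma hnorm_w_le : hnorm w <= 113 / 100 * gamma.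
Proof.
have H1 := half_g11_variation.
have H2 := @jet_g_hat_near_id x w q_le; rewrite -/q in H2.
have H3 := hnorm_w0_le.
have : w = w0 + (2^-1 *: jet g (xi + x) [:: e1; e1] - w0) - (jet g (xi + x) [:: hat w] - w).
  by rewrite w_eq [w0 + _]addrC subrK opprB addrC subrK.
move/(congr1 (@hnorm R m)) => E.
have := hnormB (w0 + (2^-1 *: jet g (xi + x) [:: e1; e1] - w0)) (jet g (xi + x) [:: hat w] - w).
rewrite -E => T1; have := hnormD w0 (2^-1 *: jet g (xi + x) [:: e1; e1] - w0) => T2.
exact: hnorm_w_arith T1 T2 H3 H1 H2 (ler_wpM2l gamma_ge0 q_le)
  (ler_wpM2l (hnorm_ge0 w) q_le) gamma_ge0.
Qed.

Lemma hnorm_w_sub_w0_le : hnorm (w - w0) <= 561 / 100 * (gamma * q).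
Proof.
have H1 := half_g11_variation.
have H2 := @jet_g_hat_near_id x w q_le; rewrite -/q in H2.
have H3 := hnorm_w_le.
have -> : w - w0 = (2^-1 *: jet g (xi + x) [:: e1; e1] - w0) - (jet g (xi + x) [:: hat w] - w).
  by rewrite w_eq opprB [RHS]addrC addrA subrK.
apply: le_trans (hnormB _ _) _.
have := ler_wpM2l q_ge0 H3.
have : 0 <= gamma * q by rewrite mulr_ge0.
lra.
Qed.

(** L_3(f_n) and Gamma_1(f_n) at xi + x, divided by Delta_3(f_n): multiplying a row of
    derivatives by w amounts to differentiating in the direction (0, w). *)
Definition L_jet := 6^-1 *: jet h (xi + x) [:: e1; e1; e1] - jet h (xi + x) [:: e1; hat w].
Definition Gamma_jet := 6^-1 *: jet h (xi + x) [:: e1; e1] - jet h (xi + x) [:: hat w].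

(** By normalisation L is 1 at xi; its change splits into that of the third derivative
    along X_1, that of the mixed derivative with w fixed, and that due to w - w0. *)
Lemma L_jet_near1 : hnorm (L_jet - 1%:M) <= 23 * gamma ^+ 2 * q.
Proof.
have HW := hnorm_w_le; have HD := hnorm_w_sub_w0_le.
pose A := jet h (xi + x) [:: e1; e1; e1] - jet h xi [:: e1; e1; e1].
pose B := jet h (xi + x) [:: e1; hat w] - jet h xi [:: e1; hat w].
pose D := jet h xi [:: e1; hat (w - w0)].
have -> : L_jet - 1%:M = 6^-1 *: A - B - D.
  rewrite -h_delta /L_jet /A /B /D.
  have -> : hat (w - w0) = hat w - hat w0 by rewrite -join1N -join1D oppr0 addr0.
  rewrite (jetB h _ [:: e1]) /=.
  move: (jet h _ _) (jet h _ _) (jet h _ _) (jet h _ _) (jet h _ _) => t1 t2 t3 t4 t5.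
  by apply/matrixP => i j; rewrite !mxE; ring.
have HA : hnorm (6^-1 *: A) <= 441 / 100 * (gamma ^+ 2 * q).
  rewrite hnormZ ComplexField.Normc.normcV normc_nat ler_pdivrMl//.
  have := @jet_variation _ _ _ h xi gamma gamma_ge0 jet_h_le x [:: e1; e1; e1] isT.
  rewrite -/q big_cons prod_e1e1 hnorm_e1 /= fact3 !mulr1 => H.
  apply: le_trans (H q4_lt1) _.
  by have := ler_wpM2l (exprn_ge0 2 gamma_ge0) frac4; lra.
have HB : hnorm B <= 2 * gamma * hnorm w * (323 / 100 * q).
  have := @jet_variation _ _ _ h xi gamma gamma_ge0 jet_h_le x [:: e1; hat w] isT.
  rewrite -/q !big_cons big_nil hnorm_e1 hnorm_join01 /= fact2 expr1 mul1r mulr1 => H.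
  apply: le_trans (H q3_lt1) _.
  by rewrite ler_wpM2l ?mulr_ge0 ?hnorm_ge0.
have HDD : hnorm D <= 2 * gamma * hnorm (w - w0) by apply: jet_h_e1_hat_le.
have T1 := hnormB (6^-1 *: A - B) D; have T2 := hnormB (6^-1 *: A) B.
have gq : 0 <= gamma * q by rewrite mulr_ge0.
have HB' : gamma * q * hnorm w <= gamma * q * (113 / 100 * gamma) by rewrite ler_wpM2l.
have HD' : gamma * hnorm (w - w0) <= gamma * (561 / 100 * (gamma * q)) by rewrite ler_wpM2l.
exact: L_jet_near1_arith T1 T2 HA HB HDD HB' HD' (mulr_ge0 gamma_ge0 gq).
Qed.

(** a L - Gamma is a difference of two Euler defects, for D_11 h and D_w h, both with
    directions a e_1 and (0, y); their linear terms in y are estimated separately. *)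
Lemma L_jet_Gamma_jet_defect :
  hnorm (a *: L_jet - Gamma_jet)
  <= gamma ^+ 2 * (586 / 100 * q * hnorm x + 326 / 100 * hnorm y).
Proof.
have HW := hnorm_w_le.
have xE : x = a *: e1 + hat y by rewrite -join1_hatD.
pose A := jet h (xi + x) [:: a *: e1; e1; e1] - jet h (xi + x) [:: e1; e1].
pose B := jet h (xi + x) [:: a *: e1; hat w] - jet h (xi + x) [:: hat w].
pose Y1 := jet h xi [:: hat y; e1; e1].
pose Y2 := jet h xi [:: hat y; hat w].
have -> : a *: L_jet - Gamma_jet = 6^-1 *: (A + Y1) - 6^-1 *: Y1 - (B + Y2) + Y2.
  rewrite /L_jet /Gamma_jet /A /B !(jetZ h _ [::]) /=.
  move: Y1 Y2 (jet h _ _) (jet h _ _) (jet h _ _) (jet h _ _) => t5 t6 t1 t2 t3 t4.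
  by apply/matrixP => i j; rewrite !mxE; ring.
have hx k : (0 < k)%N -> hnorm (k%:R *: (a *: e1) - hat y) <= k%:R * hnorm x.
  by move=> k0; have [] := hnorm_join1_mulr_le a y k0.
have X0 := hnorm_ge0 x; have Y0 := hnorm_ge0 y; have W0 := hnorm_ge0 w.
have HA : hnorm (6^-1 *: (A + Y1)) <= 221 / 100 * (gamma ^+ 2 * hnorm x * q).
  rewrite hnormZ ComplexField.Normc.normcV normc_nat ler_pdivrMl//.
  have := @euler_defect _ _ _ h xi gamma gamma_ge0 jet_h_le x (a *: e1) (hat y) [:: e1; e1] h_11 xE hx.
  rewrite -/q prod_e1e1 /= fact2 !mulr1 => H.
  apply: le_trans (H q4_lt1) _.
  have gx : 0 <= gamma ^+ 2 * hnorm x by rewrite mulr_ge0 ?exprn_ge0.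
  have := ler_wpM2l gx frac4; rewrite (_ : 'C(4, 2)%:R = 6)//.
  have -> : 6 * q / (1 - 4 * q) = 3 / 2 * (4 * q / (1 - 4 * q)) by lra.
  by have := mulr_ge0 gx q_ge0; lra.
have HB : hnorm (B + Y2) <= gamma * hnorm w * hnorm x * (323 / 100 * q).
  have := @euler_defect _ _ _ h xi gamma gamma_ge0 jet_h_le x (a *: e1) (hat y) [:: hat w] (h_grad _) xE hx.
  rewrite -/q big_seq1 hnorm_join01 /= (_ : 1`!%:R = 1)// expr1 !mul1r => H.
  apply: le_trans (H q3_lt1) _.
  by rewrite ler_wpM2l ?mulr_ge0 ?hnorm_ge0// (_ : 'C(3, 2)%:R = 3).
have HY1 : hnorm (6^-1 *: Y1) <= gamma ^+ 2 * hnorm y.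
  rewrite hnormZ ComplexField.Normc.normcV normc_nat ler_pdivrMl// mulrA.
  exact: jet_h_hat_e1e1_le.
have HY2 : hnorm Y2 <= 2 * gamma * hnorm y * hnorm w by apply: jet_h_hat2_le.
have T1 := hnormD (6^-1 *: (A + Y1) - 6^-1 *: Y1 - (B + Y2)) Y2.
have T2 := hnormB (6^-1 *: (A + Y1) - 6^-1 *: Y1) (B + Y2).
have T3 := hnormB (6^-1 *: (A + Y1)) (6^-1 *: Y1).
have gx : 0 <= gamma * (hnorm x * q) by rewrite !mulr_ge0.
have gy : 0 <= gamma * hnorm y by rewrite mulr_ge0.
have HB' : gamma * (hnorm x * q) * hnorm w <= gamma * (hnorm x * q) * (113 / 100 * gamma).
  by rewrite ler_wpM2l.
have HY' : gamma * hnorm y * hnorm w <= gamma * hnorm y * (113 / 100 * gamma) by rewrite ler_wpM2l.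
exact: defect_arith T1 T2 T3 HA HB HY1 HY2 HB' HY' (mulr_ge0 gamma_ge0 gx) (mulr_ge0 gamma_ge0 gy).
Qed.

End AtPoint.

End NewtonStep.

Lemma gamma_mul_le (K : realFieldType) (gamma d : K) :
  1 <= gamma -> 0 <= d -> gamma * d <= gamma ^+ 3 * d.
Proof.
move=> g1 d0; have g0 : 0 <= gamma by apply: le_trans g1; apply: ler01.
by rewrite exprS -mulrA ler_wpM2l// ler_peMl// exprn_ege1.
Qed.

Lemma newton_radius_arith (K : realFieldType) (gamma d Y X : K) :
  0 <= gamma -> 0 <= d -> gamma * d <= 89%:R / 4000%:R ->
  Y <= 11 / 10 * (gamma * d) * d -> X <= d + Y -> gamma * X <= 23 / 1000.
Proof.
move=> g0 d0 vu hY hX; have hY2 := ler_wpM2r d0 vu.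
have X1 : X <= 1025 / 1000 * d by clear -hX hY hY2 d0; lra.
by have := ler_wpM2l g0 X1; clear -vu; lra.
Qed.

(** The numbers a radius u <= 0.02225 leads to: ||p - xi|| <= 1.025 d, a denominator
    of at least 0.4754 and a numerator of at most 9.75 u d, hence a first coordinate of
    at most 20.52 u d, to which the 1.1 gamma d^2 of the other coordinates are added. *)
Lemma newton_step_arith (K : realFieldType) (gamma d Y X l num na : K) :
  1 <= gamma -> 0 <= d -> gamma ^+ 3 * d <= 89%:R / 4000%:R ->
  0 <= Y -> Y <= 11 / 10 * (gamma * d) * d -> 0 <= X -> X <= d + Y ->
  1 <= l + 23 * gamma ^+ 2 * (gamma * X) ->
  num <= gamma ^+ 2 * (586 / 100 * (gamma * X) * X + 326 / 100 * Y) ->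
  0 < l /\ (na * l = num -> na + Y <= 22 * (gamma ^+ 3 * d) * d).
Proof.
move=> g1 d0 u1 Y0 hY X0 hX hl hnum.
have g0 : 0 <= gamma by apply: le_trans g1; apply: ler01.
set u := gamma ^+ 3 * d in u1 *.
have u0 : 0 <= u by rewrite mulr_ge0 ?exprn_ge0.
have vu : gamma * d <= u by apply: gamma_mul_le.
have v0 : 0 <= gamma * d by rewrite mulr_ge0.
have hY2 : (gamma * d) * d <= 89%:R / 4000%:R * d by rewrite ler_wpM2r// (le_trans vu).
have X1 : X <= 1025 / 1000 * d by clear -hX hY hY2 d0; lra.
have X2 : X * X <= 1025 / 1000 * d * (1025 / 1000 * d) by rewrite ler_pM.
have hl2 : gamma ^+ 2 * (gamma * X) <= 1025 / 1000 * u.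
  by have := ler_wpM2l (exprn_ge0 3 g0) X1; rewrite /u mulrA -exprSr; clear; lra.
have l1 : 47 / 100 < l by clear -hl hl2 u1; lra.
have l0 : 0 < l by clear -l1; lra.
have ud0 : 0 <= u * d by rewrite mulr_ge0.
have hnum2 : num <= 975 / 100 * (u * d).
  have A : gamma ^+ 3 * (X * X) <= 1051 / 1000 * (u * d).
    have := ler_wpM2l (exprn_ge0 3 g0) X2; move: ud0; rewrite /u; clear; lra.
  have B : gamma ^+ 2 * Y <= 11 / 10 * (u * d).
    have := ler_wpM2l (exprn_ge0 2 g0) hY; rewrite /u (exprSr gamma 2); clear; lra.
  by move: hnum A B; rewrite (exprSr gamma 2); clear -ud0; lra.
have hl3 : 4754%:R / 10000%:R <= l by clear -hl hl2 u1; lra.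
split=> // hna; have hna2 : na <= 2052 / 100 * (u * d).
  rewrite -(ler_pM2r l0) hna; have := ler_wpM2l ud0 hl3; move: hnum2; clear -ud0; lra.
have := ler_wpM2r d0 vu; move: hna2 hY ud0; clear; lra.
Qed.

(** * Taylor coefficients are bounded by powers of gamma *)

Lemma unitmx_inj (K : fieldType) n (M : 'M[K]_n) :
  (forall w : 'cV_n, M *m w = 0 -> w = 0) -> M \in unitmx.
Proof.
move=> inj; rewrite -unitmx_tr -row_free_unit; apply: inj_row_free => v vM.
have := inj v^T; rewrite -[X in X = 0 -> _]trmxK trmx_mul trmxK vM trmx0 => /(_ erefl).
by move/(congr1 trmx); rewrite trmxK trmx0.
Qed.

Section GammaBound.
Variable R : realType.
Local Notation C := R[i].

(** A supremum is an upper bound only of a set that is bounded above, which is where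
    [jet_bounded] is used. *)
Lemma opnorm_jet_spec n p (F : 'I_p -> {mpoly C[n]}) (xi : 'cV[C]_n) k
  (t := opnorm (fun vs : k.-tuple 'cV[C]_n => (k`!)%:R^-1 *: jet F xi vs)) :
  [/\ 0 <= t, (jet_order_bound F <= k)%N -> t = 0
    & forall vs, size vs = k -> (forall v, v \in vs -> hnorm v <= 1) ->
        hnorm (jet F xi vs) <= (k`!)%:R * t].
Proof.
have fk : 0 < (k`!)%:R :> R by rewrite ltr0n fact_gt0.
have [K HK] := jet_bounded F xi k.
pose S := [set hnorm ((k`!)%:R^-1 *: jet F xi vs) | vs in
   [set vs : k.-tuple 'cV[C]_n | forall i, hnorm (tnth vs i) <= 1]]%classic.
have tE : t = sup S by [].
have inS (vs : k.-tuple 'cV[C]_n) : (forall v, v \in val vs -> hnorm v <= 1) ->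
    S (hnorm ((k`!)%:R^-1 *: jet F xi vs)).
  by move=> hvs; exists vs => // i; apply: hvs; rewrite mem_tnth.
have hK (vs : k.-tuple 'cV[C]_n) : (forall i, hnorm (tnth vs i) <= 1) ->
    hnorm (jet F xi vs) <= K.
  move=> hvs; apply: HK; first by rewrite size_tuple.
  by move=> v /tnthP[i ->].
have Sub : has_ubound S.
  exists ((k`!)%:R^-1 * K) => _ [vs /= hvs <-].
  rewrite hnormZ ComplexField.Normc.normcV normc_nat ler_wpM2l ?invr_ge0 ?ler0n ?hK//.
have ge vs : size vs = k -> (forall v, v \in vs -> hnorm v <= 1) ->
    hnorm (jet F xi vs) <= (k`!)%:R * t.
  move=> /eqP szvs hvs; rewrite -ler_pdivrMl// tE; apply: ub_le_sup => //.
  have := inS (Tuple szvs) hvs.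
  by rewrite hnormZ ComplexField.Normc.normcV normc_nat.
have hzero v : v \in nseq k (0 : 'cV[C]_n) -> hnorm v <= 1.
  by rewrite mem_nseq => /andP[_ /eqP ->]; rewrite hnorm0.
split=> //.
  have := ge _ (size_nseq _ _) hzero => /(le_trans (hnorm_ge0 _)).
  by rewrite pmulr_rge0.
move=> hk; rewrite tE (_ : S = [set 0]%classic) ?sup1//.
have z (vs : k.-tuple 'cV[C]_n) : (k`!)%:R^-1 *: jet F xi vs = 0.
  by rewrite jet_eq0 ?scaler0 ?size_tuple.
apply/seteqP; split=> [_ [vs _ <-]|_ ->]; rewrite /= ?z ?hnorm0//.
by exists (nseq_tuple k 0); rewrite /= ?z ?hnorm0// => i; rewrite tnth_nseq hnorm0.
Qed.

(** The supremum over k bounds its members because only finitely many are nonzero. *)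
Lemma le_sup_root (t : nat -> R) N :
  (forall k, 0 <= t k) -> (forall k, (N <= k)%N -> t k = 0) ->
  forall k gamma, (2 <= k)%N ->
    sup [set t k `^ (k.-1)%:R^-1 | k in [set k | (2 <= k)%N]]%classic <= gamma ->
    t k <= gamma ^+ k.-1.
Proof.
move=> t0 tN k gamma k2 hg.
set S := [set _ | _ in _]%classic in hg.
have Sub : has_ubound S.
  exists (\sum_(j < N) t j `^ (j.-1)%:R^-1) => _ [j /= j2 <-].
  have [jN|Nj] := ltnP j N.
    by rewrite (bigD1 (Ordinal jN))//= lerDl sumr_ge0// => i _; rewrite powR_ge0.
  rewrite tN// powR0 ?sumr_ge0// => [i _|]; first by rewrite powR_ge0.
  by rewrite invr_eq0 pnatr_eq0 -lt0n; case: j j2 {Nj} => [|[]].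
have h : t k `^ (k.-1)%:R^-1 <= gamma by apply: le_trans hg; apply: ub_le_sup => //; exists k.
have k1 : (k.-1)%:R != 0 :> R by rewrite pnatr_eq0 -lt0n; case: k k2 {h} => [|[]].
have -> : t k = (t k `^ (k.-1)%:R^-1) ^+ k.-1.
  by rewrite -powR_mulrn ?powR_ge0// -powRrM mulVf// powRr1.
by rewrite lerXn2r// nnegrE ?powR_ge0// (le_trans _ h) ?powR_ge0.
Qed.

End GammaBound.

(** * The iteration in terms of jets *)

Section ModifiedNewton.
Variables (R : realType) (m : nat).
Local Notation C := R[i].
Variables (f : 'I_m.+1 -> {mpoly C[m.+1]}) (xi : 'cV[C]_m.+1).
Hypothesis triple : simple_triple_zero f xi.

Local Notation e1 := (join1 1 (0 : 'cV[C]_m)).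
Local Notation hat := (@join1 R m 0).

Lemma dirderiv_e1 (p : {mpoly C[m.+1]}) : dirderiv e1 p = p^`M(ord0).
Proof.
rewrite /dirderiv big_ord_recl join1_ord0 scale1r big1 ?addr0// => j _.
by rewrite join1_lift mxE scale0r.
Qed.

Lemma dirderiv_hat (w : 'cV[C]_m) (p : {mpoly C[m.+1]}) :
  dirderiv (hat w) p = \sum_j w j 0 *: p^`M(lift ord0 j).
Proof.
rewrite /dirderiv big_ord_recl join1_ord0 scale0r add0r.
by apply: eq_bigr => j _; rewrite join1_lift.
Qed.

Lemma mev_sumZ x n' (c : 'I_n' -> C) (p : 'I_n' -> {mpoly C[m.+1]}) :
  mev x (\sum_j c j *: p j) = \sum_j mev x (p j) * c j.
Proof. by rewrite /mev raddf_sum; apply: eq_bigr => j _ /=; rewrite mevalZ mulrC. Qed.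

Lemma Dfhat_jet x (w : 'cV[C]_m) : Dfhat f x *m w = jet (fhat f) x [:: hat w].
Proof.
apply/colP => i; rewrite !mxE /= dirderiv_hat mev_sumZ.
by apply: eq_bigr => j _; rewrite mxE.
Qed.

Lemma fhat_11_jet x : fhat_11 f x = jet (fhat f) x [:: e1; e1].
Proof. by apply/colP => i; rewrite !mxE /= !dirderiv_e1. Qed.

Definition scaled_fhat (i : 'I_m) : {mpoly C[m.+1]} :=
  \sum_j invmx (Dfhat f xi) i j *: fhat f j.

(** Written as a one-row matrix combination so that [jet_comb] applies. *)
Definition scaled_flast (i : 'I_1) : {mpoly C[m.+1]} :=
  \sum_(j < 1) ((L3 f xi)^-1%:M : 'M_1) i j *: flast f.

Lemma jet_scaled_fhat x vs : jet scaled_fhat x vs = invmx (Dfhat f xi) *m jet (fhat f) x vs.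
Proof. exact: jet_comb. Qed.

Lemma jet_scaled_flast x vs :
  jet scaled_flast x vs = ((L3 f xi)^-1 * mev x (foldr (@dirderiv R m.+1) (flast f) vs))%:M.
Proof.
rewrite /scaled_flast (jet_comb _ (fun=> flast f)) mul_scalar_mx.
by apply/colP => i; rewrite ord1 !mxE mulr1n.
Qed.

Let A_unit : Dfhat f xi \in unitmx. Proof. by case: triple. Qed.

Lemma scaled_fhat_zero : jet scaled_fhat xi [::] = 0.
Proof.
rewrite jet_scaled_fhat (_ : jet _ _ _ = 0) ?mulmx0//.
by apply/colP => i; rewrite !mxE /=; case: triple => h _ _ _ _; exact: h.
Qed.

Lemma scaled_fhat_e1 : jet scaled_fhat xi [:: e1] = 0.
Proof.
rewrite jet_scaled_fhat (_ : jet _ _ _ = 0) ?mulmx0//.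
by apply/colP => i; rewrite !mxE /= dirderiv_e1; case: triple => _ _ /(_ (lift ord_max i)) [].
Qed.

Lemma scaled_fhat_hat w : jet scaled_fhat xi [:: hat w] = w.
Proof. by rewrite jet_scaled_fhat -Dfhat_jet; exact: mulKmx A_unit w. Qed.

Lemma scaled_flast_grad v : jet scaled_flast xi [:: v] = 0.
Proof.
rewrite jet_scaled_flast /= /dirderiv /mev raddf_sum big1 ?mulr0 ?raddf0// => i _ /=.
rewrite mevalZ; case: triple => _ _ /(_ i) [_ hi] _ _.
by move: hi; rewrite /mev => ->; rewrite mulr0.
Qed.

Lemma scaled_flast_11 : jet scaled_flast xi [:: e1; e1] = 0.
Proof.
rewrite jet_scaled_flast /= !dirderiv_e1; case: triple => _ _ _ h _.
by rewrite h mulr0 raddf0.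
Qed.

Lemma flast_hat_jet x (w : 'cV[C]_m) :
  (flast_hat f x *m w) 0 0 = mev x (dirderiv (hat w) (flast f)).
Proof. by rewrite dirderiv_hat mev_sumZ mxE; apply: eq_bigr => j _; rewrite mxE. Qed.

Lemma flast_1hat_jet x (w : 'cV[C]_m) :
  (flast_1hat f x *m w) 0 0 = mev x (dirderiv (hat w) (flast f))^`M(ord0).
Proof.
rewrite dirderiv_hat raddf_sum /=.
under [in RHS]eq_bigr do rewrite mderivZ.
by rewrite mev_sumZ mxE; apply: eq_bigr => j _; rewrite mxE.
Qed.

Section Correction.
Variables (x : 'cV[C]_m.+1) (w : 'cV[C]_m).
Hypothesis wE : w = invmx (Dfhat f x) *m (2^-1 *: fhat_11 f x).

Lemma L3_jet :
  6^-1 *: jet scaled_flast x [:: e1; e1; e1] - jet scaled_flast x [:: e1; hat w]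
  = ((L3 f xi)^-1 * L3 f x)%:M.
Proof.
have -> : L3 f x = 6^-1 * mev x (((flast f)^`M(ord0))^`M(ord0))^`M(ord0)
               - mev x (dirderiv (hat w) (flast f))^`M(ord0).
  by rewrite -flast_1hat_jet wE mulmxA.
rewrite !jet_scaled_flast /= !dirderiv_e1.
by rewrite scale_scalar_mx -raddfB mulrBr [6^-1 * _]mulrCA.
Qed.

Lemma Gamma1_jet :
  6^-1 *: jet scaled_flast x [:: e1; e1] - jet scaled_flast x [:: hat w]
  = ((L3 f xi)^-1 * Gamma1 f x)%:M.
Proof.
have -> : Gamma1 f x = 6^-1 * mev x ((flast f)^`M(ord0))^`M(ord0)
                   - mev x (dirderiv (hat w) (flast f)).
  by rewrite -flast_hat_jet wE mulmxA.
rewrite !jet_scaled_flast /= !dirderiv_e1.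
by rewrite scale_scalar_mx -raddfB mulrBr [6^-1 * _]mulrCA.
Qed.

End Correction.

Lemma jet_scaled_fhat_newton x (w : 'cV[C]_m) : Dfhat f x \in unitmx ->
  w = invmx (Dfhat f x) *m (2^-1 *: fhat_11 f x) ->
  jet scaled_fhat x [:: hat w] = 2^-1 *: jet scaled_fhat x [:: e1; e1].
Proof.
by move=> u ->; rewrite !jet_scaled_fhat -Dfhat_jet mulKVmx// fhat_11_jet scalemxAr.
Qed.

Local Notation gamma := (gamma3 f xi).

Lemma gamma3_ge1 : 1 <= gamma.
Proof. by rewrite /gamma3 le_max lexx. Qed.

Lemma gamma_jet_le p (F : 'I_p -> {mpoly C[m.+1]}) (t : nat -> R) :
  (forall k, t k = opnorm (fun vs : k.-tuple 'cV[C]_m.+1 => (k`!)%:R^-1 *: jet F xi vs)) ->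
  sup [set t k `^ (k.-1)%:R^-1 | k in [set k | (2 <= k)%N]]%classic <= gamma ->
  forall vs, (2 <= size vs)%N ->
  hnorm (jet F xi vs) <= (size vs)`!%:R * gamma ^+ (size vs).-1 * \prod_(v <- vs) hnorm v.
Proof.
move=> tE hg vs szvs; apply: (jet_homogeneous_bound (k := size vs)) => // us szus hus.
have [_ _ /(_ us szus hus)] := opnorm_jet_spec F xi (size vs); rewrite -tE => /le_trans; apply.
rewrite ler_wpM2l//; apply: (@le_sup_root _ t (jet_order_bound F)) => // k.
  by rewrite tE; have [] := opnorm_jet_spec F xi k.
by rewrite tE; have [] := opnorm_jet_spec F xi k.
Qed.

Lemma jet_scaled_fhat_le vs : (2 <= size vs)%N ->
  hnorm (jet scaled_fhat xi vs) <= (size vs)`!%:R * gamma ^+ (size vs).-1 * \prod_(v <- vs) hnorm v.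
Proof.
apply: (@gamma_jet_le _ scaled_fhat (fhat_term f xi)) => [k|].
  rewrite /fhat_term; congr opnorm; apply: boolp.funext => us.
  by rewrite (jet_scaled_fhat xi us).
by rewrite /gamma3 le_max; apply/orP; right; rewrite le_max; apply/orP; left; apply: lexx.
Qed.

Lemma jet_scaled_flast_le vs : (2 <= size vs)%N ->
  hnorm (jet scaled_flast xi vs) <= (size vs)`!%:R * gamma ^+ (size vs).-1 * \prod_(v <- vs) hnorm v.
Proof.
apply: (@gamma_jet_le _ scaled_flast (flast_term f xi)) => [k|].
  rewrite /flast_term; congr opnorm; apply: boolp.funext => us.
  by rewrite (jet_scaled_flast xi us) scale_scalar_mx mulrCA.
by rewrite /gamma3 le_max; apply/orP; right; rewrite le_max; apply/orP; right; apply: lexx.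
Qed.

End ModifiedNewton.

(** * Quadratic convergence *)

Lemma Nf_quadratic (R : realType) (m : nat) (f : 'I_m.+1 -> {mpoly R[i][m.+1]})
    (xi z : 'cV[R[i]]_m.+1) (d := hnorm (z - xi)) :
  simple_triple_zero f xi -> gamma3 f xi ^+ 3 * d <= 89%:R / 4000%:R ->
  hnorm (Nf f z - xi) <= 22 * (gamma3 f xi ^+ 3 * d) * d.
Proof.
move=> triple hu; set gamma := gamma3 f xi in hu *.
have g1 : 1 <= gamma := gamma3_ge1 f xi.
have g0 : 0 <= gamma := le_trans ler01 g1.
have d0 : 0 <= d := hnorm_ge0 _.
have hv : gamma * d <= 89%:R / 4000%:R := le_trans (gamma_mul_le g1 d0) hu.
have gle := @jet_scaled_fhat_le _ _ f xi; have hle := @jet_scaled_flast_le _ _ f xi.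
have ghat := scaled_fhat_hat triple.
have unit_at x : gamma * hnorm x <= 23 / 1000 -> Dfhat f (xi + x) \in unitmx.
  move=> hx; apply: unitmx_inj => w Mw0.
  by apply: (jet_g_hat_inj g1 gle ghat hx); rewrite jet_scaled_fhat -Dfhat_jet Mw0 mulmx0.
pose a := (z - xi) ord0 0; pose v := row' ord0 (z - xi).
have zxi : z - xi = join1 a v by rewrite join1K.
have zE : z = xi + join1 a v by rewrite -zxi addrC subrK.
have dE : d = hnorm (join1 a v) by rewrite /d zxi.
have uz : Dfhat f z \in unitmx.
  by rewrite zE; apply: unit_at; rewrite -dE; clear -hv; lra.
pose s := invmx (Dfhat f z) *m fhat_at f z; pose y := v - s.
have hY : hnorm y <= 11 / 10 * (gamma * d) * d.
  rewrite dE; apply: (newton_hat_step g1 gle (scaled_fhat_zero triple) (scaled_fhat_e1 triple) ghat).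
    by rewrite -dE.
  rewrite -zE !jet_scaled_fhat -Dfhat_jet mulKVmx//.
pose p := join1 (z ord0 0) (N1 f z).
have pE : p = xi + join1 a y.
  rewrite /p /N1 -/s -[in RHS](join1K xi) -join1D; congr join1.
    by rewrite /a !mxE [RHS]addrC subrK.
  by rewrite /y /v addrA; congr (_ - _); apply/colP => i; rewrite !mxE [RHS]addrC subrK.
have hX : hnorm (join1 a y) <= d + hnorm y.
  rewrite join1_hatD; apply: le_trans (hnormD _ _) _.
  rewrite hnormZ hnorm_e1 mulr1 hnorm_join01 lerD2r /d.
  exact: normc_le_hnorm.
have hq : gamma * hnorm (join1 a y) <= 23 / 1000 := newton_radius_arith g0 d0 hv hY hX.
have up : Dfhat f p \in unitmx by rewrite pE; apply: unit_at.
pose w := invmx (Dfhat f p) *m (2^-1 *: fhat_11 f p).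
have wE : w = invmx (Dfhat f p) *m (2^-1 *: fhat_11 f p) by [].
have hw := jet_scaled_fhat_newton xi up wE; rewrite pE in hw.
pose l := (L3 f xi)^-1 * L3 f p; pose c := (L3 f xi)^-1 * Gamma1 f p.
have lE : L_jet (scaled_flast f xi) xi a y w = l%:M by rewrite /L_jet -pE; apply: L3_jet.
have cE : Gamma_jet (scaled_flast f xi) xi a y w = c%:M by rewrite /Gamma_jet -pE; apply: Gamma1_jet.
have L0 : L3 f xi != 0 by case: triple.
(* At xi itself L_3 is Delta_3, which normalises L to 1. *)
have w0E : 2^-1 *: jet (scaled_fhat f xi) xi [:: join1 1 0; join1 1 0]
    = invmx (Dfhat f xi) *m (2^-1 *: fhat_11 f xi).
  by rewrite (jet_scaled_fhat f xi xi _) (fhat_11_jet f xi); exact: scalemxAr.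
have hdelta := L3_jet xi w0E; rewrite (mulVf L0) in hdelta.
have hl := L_jet_near1 g1 gle hle ghat hdelta hq hw.
have hn := L_jet_Gamma_jet_defect g1 gle hle ghat (scaled_flast_grad triple) (scaled_flast_11 triple) hq hw.
rewrite lE -raddfB hnorm_cV1 /= mxE mulr1n in hl.
rewrite lE cE scale_scalar_mx -raddfB hnorm_cV1 /= mxE mulr1n in hn.
have hl1 : 1 <= normc l + 23 * gamma ^+ 2 * (gamma * hnorm (join1 a y)).
  apply: le_trans (lerD (lexx _) hl).
  have := le_normcD l (1 - l); rewrite addrC subrK ComplexField.Normc.normc1.
  by rewrite -[in X in _ <= X](normcN (1 - l)) opprB.
have [l0 fin] := newton_step_arith (normc (a - l^-1 * c)) g1 d0 hu (hnorm_ge0 y) hY (hnorm_ge0 _) hX hl1 hn.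
have ln0 : l != 0 by apply: contraTneq l0 => ->; rewrite ComplexField.Normc.normc0 ltxx.
(* The factors 1 / Delta_3 of l and c cancel in the quotient. *)
have -> : Nf f z - xi = join1 (a - l^-1 * c) y.
  have -> : Nf f z = xi + join1 (a - l^-1 * c) y.
    have -> : l^-1 * c = (L3 f p)^-1 * Gamma1 f p.
      by rewrite /l /c invfM invrK mulrACA divff// mul1r.
    rewrite -[xi in RHS]join1K -join1D /Nf /N2 -/p; congr join1.
      by rewrite /a !mxE addrA; congr (_ - _); rewrite [RHS]addrC subrK.
    rewrite /N1 -/s /y /v addrA; congr (_ - _); apply/colP => i.
    by rewrite !mxE [RHS]addrC subrK.
  by rewrite addrAC subrr add0r.
apply: le_trans (fin _); last first.
  by rewrite -ComplexField.Normc.normcM mulrBl mulrAC mulVf// mul1r.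
rewrite join1_hatD; apply: le_trans (hnormD _ _) _.
by rewrite hnormZ hnorm_e1 mulr1 hnorm_join01.
Qed.

(** * The thresholds u_3 and u_3' *)

Section Thresholds.
Variable R : realType.
Implicit Types s t u : R.

(** Reduced numerators and denominators: the factor (2u-1)^4 and one factor
    8u^2 - 8u + 1 of b_{3,3} cancel. *)
Definition num21 u := (1 - 2 * u) ^+ 2 * u.
Definition quad u := 8 * u ^+ 2 - 8 * u + 1.
Definition den6 u :=
  128%:R * u ^+ 6 - 384%:R * u ^+ 5 + 464%:R * u ^+ 4 - 320%:R * u ^+ 3
  + 136%:R * u ^+ 2 - 30%:R * u + 1.
Definition num33 u :=
  42%:R * u - 702%:R * u ^+ 2 + 5368%:R * u ^+ 3 - 26342%:R * u ^+ 4
  + 85997%:R * u ^+ 5 - 188614%:R * u ^+ 6 + 282020%:R * u ^+ 7 - 289640%:R * u ^+ 8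
  + 202336%:R * u ^+ 9 - 92480%:R * u ^+ 10 + 25088%:R * u ^+ 11 - 3072%:R * u ^+ 12.
Definition den21 u := quad u * (1 - u).
Definition den33 u := 3 * den6 u * quad u * (u - 1) ^+ 4.

(** On [0, 9/400] the increment of t^(k+1) is at most 9/200 times that of t^k, since
    t^(k+1) - s^(k+1) <= (t + s)(t^k - s^k).  A polynomial with alternating signs whose
    successive coefficients grow by a factor below 200/9 is therefore monotone, its
    terms being grouped in pairs; the monotonicity lemmas below are linear consequences
    of these inequalities. *)
Lemma expr_diff_step s t k (e := fun j => t ^+ j - s ^+ j) :
  0 <= s -> s <= t -> t <= 9 / 400%:R -> 0 <= e k.+1 /\ e k.+2 <= 9 / 200%:R * e k.+1.
Proof.
move=> s0 st t1; have t0 := le_trans s0 st.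
have ek j : 0 <= e j by rewrite subr_ge0 lerXn2r// nnegrE.
split; first exact: ek.
have E1 : e k.+2 = t * e k.+1 + s ^+ k.+1 * (t - s) by rewrite /e !exprS; ring.
have E2 : s ^+ k.+1 * (t - s) <= s * e k.+1.
  rewrite (_ : e k.+1 = t * e k + s ^+ k * (t - s)); last by rewrite /e !exprS; ring.
  rewrite [s * (_ + _)]mulrDr exprS -[s * s ^+ k * _]mulrA lerDr.
  by rewrite !mulr_ge0.
by have := ek k.+1; move: (e k.+1) E1 E2 => x E1 E2 x0; nra.
Qed.

Let power_steps s t := expr_diff_step (s := s) (t := t).

Lemma quad_den_decr s t : 0 <= s -> s <= t -> t <= 9 / 400%:R ->
  [/\ 0 < quad t <= quad s, 0 < den6 t <= den6 s & 0 < (t - 1) ^+ 4 <= (s - 1) ^+ 4].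
Proof.
move=> s0 st t1; have t0 := le_trans s0 st.
have S k := power_steps k s0 st t1; have S0 k := power_steps k (lexx 0) t0 t1.
split.
- have [a1 b1] := S 0%N; have := sqr_ge0 t.
  by move=> a2; apply/andP; split; rewrite /quad; lra.
- have [] := (S 0, S 2, S 4)%N => -[[a1 b1] [a3 b3]] [a5 b5].
  have [] := (S0 1, S0 3, S0 5)%N => -[[c1 d1] [c3 d3]] [c5 d5].
  rewrite !expr0n /= in c1 c3 c5 d1 d3 d5.
  by apply/andP; split; rewrite /den6; lra.
- have h : 0 < 1 - t by lra.
  have E u : (u - 1) ^+ 4 = (1 - u) ^+ 4 by ring.
  by rewrite !E exprn_gt0//= lerXn2r ?nnegrE//; lra.
Qed.

Lemma num33_incr s t : 0 <= s -> s < t -> t <= 9 / 400%:R -> num33 s < num33 t.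
Proof.
move=> s0 st t1; have S k := power_steps k s0 (ltW st) t1.
have [] := (S 0, S 2, S 4)%N => -[[a1 b1] [a3 b3]] [a5 b5].
have [] := (S 6, S 8, S 10)%N => -[[a7 b7] [a9 b9]] [a11 b11].
by rewrite /num33; lra.
Qed.

Lemma num21_incr s t : 0 <= s -> s <= t -> t <= 9 / 400%:R -> num21 s <= num21 t.
Proof.
move=> s0 st t1; have S k := power_steps k s0 st t1.
have [a1 b1] := S 0%N; have [a3 b3] := S 2%N.
by rewrite /num21; lra.
Qed.

Lemma in_range_gt0 u : 0 <= u -> u <= 9 / 400%:R ->
  [/\ 0 < quad u, 0 < den6 u, 0 < den21 u & 0 < den33 u].
Proof.
move=> u0 u1; have [/andP[q _] /andP[d _] /andP[p _]] := quad_den_decr u0 (lexx u) u1.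
split=> //; first by rewrite /den21 mulr_gt0//; lra.
by rewrite /den33 mulr_gt0// mulr_gt0// mulr_gt0.
Qed.

Lemma b21E u : b21 u = num21 u / den21 u.
Proof. by rewrite /b21 /num21 /den21 /quad; congr (_ / _); ring. Qed.

Lemma b33E u : 0 <= u -> u <= 9 / 400%:R -> b33 u = num33 u / den33 u.
Proof.
move=> u0 u1; have [q d _ _] := in_range_gt0 u0 u1.
rewrite /b33 /a3 -[8 * _ - _ + _]/(quad u).
rewrite (_ : 128 * _ - _ + _ - _ + _ - _ + _ = den6 u)//.
rewrite (_ : 3072%:R * _ - _ + _ - _ + _ - _ + _ - _ + _ - _ + _ - _ = - num33 u); last first.
  by rewrite /num33; ring.
rewrite /den33; move: (num33 u) => P; move: q d; move: (quad u) (den6 u) => q d q0 d0.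
have h1 : 2 * u - 1 != 0 by rewrite lt_eqF//; lra.
have h2 : u - 1 != 0 by rewrite lt_eqF//; lra.
field; rewrite h1 h2 !gt_eqF//.
Qed.

Definition thresholdF u := 2 * b21 u ^+ 2 + 2 * b33 u ^+ 2.

Lemma thresholdF_incr s t : 0 <= s -> s < t -> t <= 9 / 400%:R ->
  thresholdF s < thresholdF t.
Proof.
move=> s0 st t1; have t0 := le_trans s0 (ltW st); have s1 := le_trans (ltW st) t1.
have [/andP[q _] /andP[d1 d2] /andP[p1 p2]] := quad_den_decr s0 (ltW st) t1.
have [_ _ D21s D33s] := in_range_gt0 s0 s1; have [_ _ D21t D33t] := in_range_gt0 t0 t1.
have [/andP[_ q2] _ _] := quad_den_decr s0 (ltW st) t1.
have e21 : den21 t <= den21 s.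
  by rewrite /den21 ler_pM// ?(ltW q)//; lra.
have e33 : den33 t <= den33 s.
  rewrite /den33; apply: ler_pM _ (ltW p1) _ p2; first by rewrite !mulr_ge0 ?(ltW q) ?(ltW d1).
  apply: ler_pM _ (ltW q) _ q2; first by rewrite mulr_ge0 ?(ltW d1).
  by rewrite ler_wpM2l.
have n33 := num33_incr s0 st t1; have n21 := num21_incr s0 (ltW st) t1.
have n21s : 0 <= num21 s by rewrite mulr_ge0 ?sqr_ge0.
have n33s : 0 <= num33 s.
  have z0 : num33 0 = 0 by rewrite /num33; lra.
  have [-> |sp] := eqVneq s 0; first by rewrite z0.
  by rewrite -z0 ltW// num33_incr// lt_def sp.
rewrite /thresholdF !b21E !b33E//.
have h21 : num21 s / den21 s <= num21 t / den21 t.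
  by rewrite ler_pM ?invr_ge0 ?(ltW D21s)// lef_pV2.
have h33 : num33 s / den33 s < num33 t / den33 t.
  apply: (@le_lt_trans _ _ (num33 s / den33 t)).
    by rewrite ler_wpM2l// lef_pV2.
  by rewrite ltr_pM2r ?invr_gt0.
have a0 : 0 <= num21 s / den21 s by rewrite divr_ge0// ltW.
have b0 : 0 <= num33 s / den33 s by rewrite divr_ge0// ltW.
apply: ler_ltD; rewrite ?ler_pM2l ?ltr_pM2l//.
  by rewrite lerXn2r// nnegrE// (le_trans a0).
by rewrite ltrXn2r// ?nnegrE// (le_trans b0)// ltW.
Qed.

(** F - c times a positive square is a polynomial, so its zero comes from the
    intermediate value theorem over a real closed field; a smaller solution would
    contradict monotonicity. *)
Lemma thresholdF_crossing (lo hi c : R) :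
  0 < lo -> lo < hi -> hi <= 9 / 400%:R ->
  thresholdF lo < c -> c < thresholdF hi ->
  exists2 u, lo < u < hi & smallest_positive_solution
    (fun u : R => 2 * b21 u ^+ 2 + 2 * b33 u ^+ 2) c u.
Proof.
move=> lo0 lohi hi1 Flo Fhi.
have [N21 N21E] : exists p : {poly R}, forall u, p.[u] = num21 u.
  exists ((1%:P - 2%:R *: 'X) ^+ 2 * 'X) => u.
  by rewrite hornerM horner_exp !(hornerD, hornerN, hornerZ, hornerX, hornerC).
have [E EE] : exists p : {poly R}, forall u, p.[u] = quad u.
  exists (8%:R *: 'X^2 - 8%:R *: 'X + 1%:P) => u.
  by rewrite !(hornerD, hornerN, hornerZ, hornerXn, hornerX, hornerC).
have [D6 D6E] : exists p : {poly R}, forall u, p.[u] = den6 u.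
  exists (128%:R *: 'X^6 - 384%:R *: 'X^5 + 464%:R *: 'X^4 - 320%:R *: 'X^3
          + 136%:R *: 'X^2 - 30%:R *: 'X + 1%:P) => u.
  by rewrite !(hornerD, hornerN, hornerZ, hornerXn, hornerX, hornerC).
have [N33 N33E] : exists p : {poly R}, forall u, p.[u] = num33 u.
  exists (42%:R *: 'X - 702%:R *: 'X^2 + 5368%:R *: 'X^3 - 26342%:R *: 'X^4
    + 85997%:R *: 'X^5 - 188614%:R *: 'X^6 + 282020%:R *: 'X^7 - 289640%:R *: 'X^8
    + 202336%:R *: 'X^9 - 92480%:R *: 'X^10 + 25088%:R *: 'X^11 - 3072%:R *: 'X^12) => u.
  by rewrite !(hornerD, hornerN, hornerZ, hornerXn, hornerX).
have [D21 D21E] : exists p : {poly R}, forall u, p.[u] = den21 u.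
  by exists (E * (1%:P - 'X)) => u; rewrite hornerM EE !(hornerD, hornerN, hornerX, hornerC).
have [D33 D33E] : exists p : {poly R}, forall u, p.[u] = den33 u.
  exists (3%:R *: D6 * E * ('X - 1%:P) ^+ 4) => u.
  rewrite 2!hornerM EE hornerZ D6E horner_exp.
  by rewrite !(hornerD, hornerN, hornerX, hornerC).
pose p := 2%:R *: (N21 * D33) ^+ 2 + 2%:R *: (N33 * D21) ^+ 2 - c *: (D21 * D33) ^+ 2.
have pE u : p.[u] = 2 * (num21 u * den33 u) ^+ 2 + 2 * (num33 u * den21 u) ^+ 2
                    - c * (den21 u * den33 u) ^+ 2.
  by rewrite !(hornerD, hornerN, hornerZ, horner_exp, hornerM) N21E D21E N33E D33E.
have pF u : 0 <= u -> u <= 9 / 400%:R ->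
    p.[u] = (thresholdF u - c) * (den21 u * den33 u) ^+ 2 /\ 0 < (den21 u * den33 u) ^+ 2.
  move=> u0 u1; have [_ _ d21 d33] := in_range_gt0 u0 u1.
  split; last by rewrite exprn_gt0// mulr_gt0.
  rewrite pE /thresholdF b21E b33E//.
  by field; rewrite !gt_eqF.
have [|u /andP[u0 u1] /eqP pu] := @poly_ivt _ p lo hi (ltW lohi).
  apply/andP; split.
    have [-> sq] := pF lo (ltW lo0) (le_trans (ltW lohi) hi1).
    by rewrite mulr_le0_ge0 ?(ltW sq)// subr_le0 ltW.
  have [-> sq] := pF hi (le_trans (ltW lo0) (ltW lohi)) hi1.
  by rewrite mulr_ge0 ?(ltW sq)// subr_ge0 ltW.
have up := lt_le_trans lo0 u0.
have Fu : thresholdF u = c.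
  have [pu' sq] := pF u (ltW up) (le_trans u1 hi1).
  apply/eqP; rewrite -subr_eq0; move: pu; rewrite pu' => /eqP.
  by rewrite mulf_eq0 (gt_eqF sq) orbF.
exists u.
  rewrite !lt_neqAle u0 u1 !andbT; apply/andP; split; apply/eqP => h.
    by move: Flo; rewrite h Fu ltxx.
  by move: Fhi; rewrite -h Fu ltxx.
split=> // t t0 Ft; rewrite leNgt; apply/negP => tu.
have := thresholdF_incr (ltW t0) tu (le_trans u1 hi1).
by rewrite Fu -[thresholdF t]/(2 * b21 t ^+ 2 + 2 * b33 t ^+ 2) Ft ltxx.
Qed.

Lemma thresholdF_le u (p q : R) : 0 <= u -> u <= 9 / 400%:R ->
  0 <= p -> num21 u <= p * den21 u -> 0 <= num33 u -> num33 u <= q * den33 u ->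
  thresholdF u <= 2 * p ^+ 2 + 2 * q ^+ 2.
Proof.
move=> u0 u1 p0 hp n0 hq; have [_ _ D21 D33] := in_range_gt0 u0 u1.
rewrite /thresholdF b21E b33E//.
have q0 : 0 <= q by rewrite -(pmulr_lge0 _ D33) (le_trans n0).
have n21 : 0 <= num21 u by rewrite mulr_ge0 ?sqr_ge0.
rewrite lerD// ler_pM2l// lerXn2r ?nnegrE// ?ler_pdivrMr//.
  by rewrite divr_ge0// ltW.
by rewrite divr_ge0// ltW.
Qed.

Lemma thresholdF_ge u (q : R) : 0 <= u -> u <= 9 / 400%:R ->
  0 <= q -> q * den33 u <= num33 u -> 2 * q ^+ 2 <= thresholdF u.
Proof.
move=> u0 u1 q0 hq; have [_ _ D21 D33] := in_range_gt0 u0 u1.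
have hq' : q <= num33 u / den33 u by rewrite ler_pdivlMr.
rewrite /thresholdF b33E//; apply: le_trans (_ : 2 * (num33 u / den33 u) ^+ 2 <= _).
  by rewrite ler_pM2l// lerXn2r// nnegrE// (le_trans q0).
by rewrite lerDr mulr_ge0// sqr_ge0.
Qed.

Lemma smallest_solution_u3 : exists2 u : R, 443%:R / 20000%:R < u < 89%:R / 4000%:R &
  smallest_positive_solution (fun u : R => 2 * b21 u ^+ 2 + 2 * b33 u ^+ 2) 1 u.
Proof.
apply: thresholdF_crossing; try lra.
  apply: le_lt_trans (thresholdF_le (p := 251 / 10000%:R) (q := 7058%:R / 10000%:R) _ _ _ _ _ _) _;
    rewrite /num21 /num33 /den21 /den33 /den6 /quad; lra.
apply: lt_le_trans (thresholdF_ge (q := 71 / 100) _ _ _ _);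
  rewrite /num33 /den33 /den6 /quad; lra.
Qed.

Lemma smallest_solution_u3' : exists2 u : R, 307%:R / 20000%:R < u < 309%:R / 20000%:R &
  smallest_positive_solution (fun u : R => 2 * b21 u ^+ 2 + 2 * b33 u ^+ 2) (1 / 4) u.
Proof.
apply: thresholdF_crossing; try lra.
  apply: le_lt_trans (thresholdF_le (p := 167 / 10000%:R) (q := 352 / 1000) _ _ _ _ _ _) _;
    rewrite /num21 /num33 /den21 /den33 /den6 /quad; lra.
apply: lt_le_trans (thresholdF_ge (q := 354 / 1000) _ _ _ _);
  rewrite /num33 /den33 /den6 /quad; lra.
Qed.

End Thresholds.

Lemma pow2S_pred k : (2 ^ k.+1 - 1 = (2 ^ k - 1).*2.+1)%N.
Proof. by rewrite expnS; have := expn_gt0 2 k; lia. Qed.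

(** As 22 gamma^3 d < 1/2, an error h d becomes less than (1/2) h^2 d, and
    2 (2^k - 1) + 1 = 2^(k+1) - 1.  The errors never exceed d, so the quadratic bound
    applies at each step. *)
Lemma iterates_quadratic (R : realType) (m : nat) (f : 'I_m.+1 -> {mpoly R[i][m.+1]})
    (xi z : 'cV[R[i]]_m.+1) (d := hnorm (z - xi)) :
  simple_triple_zero f xi -> gamma3 f xi ^+ 3 * d <= 89%:R / 4000%:R -> 0 < d ->
  forall k, hnorm (iter k (Nf f) z - xi) <= (1 / 2) ^+ (2 ^ k - 1)%N * d
         /\ hnorm (iter k.+1 (Nf f) z - xi) < (1 / 2) ^+ (2 ^ k.+1 - 1)%N * d.
Proof.
move=> triple hu d0; set G := gamma3 f xi ^+ 3 in hu *.
have G0 : 0 <= G by rewrite exprn_ge0// (le_trans ler01) ?gamma3_ge1.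
have step k : hnorm (iter k (Nf f) z - xi) <= (1 / 2) ^+ (2 ^ k - 1)%N * d ->
    hnorm (iter k.+1 (Nf f) z - xi) < (1 / 2) ^+ (2 ^ k.+1 - 1)%N * d.
  rewrite iterS; set y := iter k _ z; set h := _ ^+ _ => hy.
  have h0 : 0 < h by rewrite exprn_gt0// divr_gt0.
  have h1 : h <= 1 by rewrite exprn_ile1//; lra.
  have yd : hnorm (y - xi) <= d by apply: le_trans hy _; rewrite ler_piMl// ltW.
  have uy : G * hnorm (y - xi) <= 89%:R / 4000%:R.
    by apply: le_trans hu; rewrite ler_wpM2l.
  apply: le_lt_trans (Nf_quadratic triple uy) _; rewrite -/G.
  rewrite pow2S_pred exprS -muln2 exprM -/h.
  have hy2 : hnorm (y - xi) * hnorm (y - xi) <= (h * d) * (h * d).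
    by rewrite ler_pM ?hnorm_ge0.
  apply: (@le_lt_trans _ _ (22 * (G * d) * (h ^+ 2 * d))).
    by have := ler_wpM2l G0 hy2; rewrite expr2; lra.
  rewrite -[X in _ < X]mulrA ltr_pM2r ?mulr_gt0 ?exprn_gt0//; lra.
have base : hnorm (iter 0 (Nf f) z - xi) <= (1 / 2) ^+ (2 ^ 0 - 1)%N * d.
  by rewrite expn0 subnn expr0 mul1r.
elim=> [|k [_ IH]]; first by split=> //; apply: step.
by split; [exact: ltW|apply/step/ltW].
Qed.

Theorem theorem10 (R : realType) (m : nat) (hn : (2 <= m.+1)%N)
    (f : 'I_m.+1 -> {mpoly R[i][m.+1]}) (xi : 'cV[R[i]]_m.+1)
    (hxi : simple_triple_zero f xi)
    (z : 'cV[R[i]]_m.+1) (hz : z <> xi) :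
  (exists u3 : R,
     [/\ smallest_positive_solution
           (fun u => 2 * b21 u ^+ 2 + 2 * b33 u ^+ 2) 1 u3,
         `|u3 - 222 / 10 ^+ 4| < 5 / 10 ^+ 5
       & gamma3 f xi ^+ 3 * hnorm (z - xi) < u3 ->
         hnorm (Nf f z - xi) < hnorm (z - xi)])
  /\
  (exists u3' : R,
     [/\ smallest_positive_solution
           (fun u => 2 * b21 u ^+ 2 + 2 * b33 u ^+ 2) (1 / 4) u3',
         `|u3' - 154 / 10 ^+ 4| < 5 / 10 ^+ 5
       & gamma3 f xi ^+ 3 * hnorm (z - xi) < u3' ->
         forall k : nat, (1 <= k)%N ->
           hnorm (iter k (Nf f) z - xi)
             < (1 / 2) ^+ (2 ^ k - 1)%N * hnorm (z - xi)]).
Proof.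
have d0 : 0 < hnorm (z - xi).
  rewrite lt_def hnorm_ge0 andbT; apply/eqP => /hnorm_eq0 /eqP.
  by rewrite subr_eq0 => /eqP.
split.
- have [u3 /andP[u3l u3r] sol] := smallest_solution_u3 R.
  exists u3; split=> // [|hu].
    by rewrite ltr_norml; apply/andP; split; lra.
  have hu' : gamma3 f xi ^+ 3 * hnorm (z - xi) <= 89%:R / 4000%:R.
    exact: ltW (lt_trans hu u3r).
  apply: lt_trans (_ : 1 / 2 * hnorm (z - xi) < _); last by lra.
  by have [_] := iterates_quadratic hxi hu' d0 0.
- have [u3 /andP[u3l u3r] sol] := smallest_solution_u3' R.
  exists u3; split=> // [|hu [//|k] _].
    by rewrite ltr_norml; apply/andP; split; lra.
  have hu' : gamma3 f xi ^+ 3 * hnorm (z - xi) <= 89%:R / 4000%:R.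
    apply: ltW (lt_trans hu (lt_trans u3r _)); lra.
  by have [] := iterates_quadratic hxi hu' d0 k.
Qed.
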